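(* Assume $\Omega_{\mathrm O}$ and $\Omega_{\mathrm I}$ satisfy the standing assumptions (1)–(5), and let $f\colon\partial\Omega_{\mathrm O}\to\mathbb R$ be continuous and bounded from below. Then $$\langle f(\psi)\rangle_{[0,1]}\le\mathfrak B_{\Omega_{\mathrm{conv}},f}\big(\langle\psi\rangle_{[0,1]}\big)$$ for every $\psi\in\boldsymbol A_\Omega$ such that $\langle\psi\rangle_{[0,1]}\notin\operatorname{int}\operatorname{conv}\Omega_{\mathrm I}$.
   Context: Let $d\ge1$. $\Omega_{\mathrm O}\subset\mathbb R^d$ is a nonempty open strictly convex set and $\Omega_{\mathrm I}\subset\Omega_{\mathrm O}$ is a closed set; $\operatorname{conv}$, $\operatorname{int}$, $\operatorname{cl}$, $\partial$ denote convex hull, interior, closure, boundary. A ray is a set $\{x+te: t\ge0\}$ with $e\ne0$. The standing assumptions are: (1) $\partial\operatorname{conv}\Omega_{\mathrm I}$ contains no rays; (2) $\operatorname{cl}\operatorname{conv}\Omega_{\mathrm I}\subset\Omega_{\mathrm O}$; (3) $\operatorname{int}\operatorname{conv}\Omega_{\mathrm I}\ne\varnothing$ and $\Omega_{\mathrm O}$ and $\operatorname{conv}\Omega_{\mathrm I}$ have congruent maximal inscribed cones (the set of directions $e$ such that some ray $\{x+te:t\ge0\}$ is contained in the set is the same for both sets); (4) the set $(\operatorname{int}\operatorname{conv}\Omega_{\mathrm I})\setminus\Omega_{\mathrm I}$ is a locally finite union of its connected components $\omega_j$ (every bounded subset of $\mathbb R^d$ meets only finitely many $\omega_j$); (5)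 for every $j$ there is a supporting hyperplane $L_j$ to $\operatorname{conv}\Omega_{\mathrm I}$ that contains $E_j:=\partial\omega_j\setminus\Omega_{\mathrm I}$. Set $\Omega=\operatorname{cl}\Omega_{\mathrm O}\setminus\Omega_{\mathrm I}$ and $\Omega_{\mathrm{conv}}=\operatorname{cl}\Omega_{\mathrm O}\setminus\operatorname{conv}\Omega_{\mathrm I}$. For a Borel set $E$ of finite positive measure, $\langle\psi\rangle_E=|E|^{-1}\int_E\psi$ (coordinate-wise). Define $\boldsymbol{A}_\Omega=\{\psi\in L_1([0,1],\mathbb R^d): \psi(x)\in\partial\Omega_{\mathrm O}\ \forall x\in[0,1],\ \langle\psi\rangle_J\notin\Omega_{\mathrm I}\text{ for every subinterval }J\subset[0,1]\}$. A function $G\colon\omega\to\mathbb R\cup\{\pm\infty\}$ on a set $\omega\subset\mathbb R^d$ is locally concave if its restriction to every convex subset of $\omega$ is concave. For a set $D$ with $\partial\Omega_{\mathrm O}\subset D\subset\operatorname{cl}\Omega_{\mathrm O}$ and a locally bounded $f\colon\partial\Omega_{\mathrm O}\to\mathbb R$, $\mathfrak B_{D,f}(x)=\inf\{G(x): G\colon D\to\mathbb R\cup\{\pm\infty\}\text{ locally concave on }D,\ G=f\text{ on }\partial\Omega_{\mathrm O}\}$, $x\in D$.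
   Formalization: The average of ψ over [0,1] is additionally assumed to lie in Ω_conv, since 𝔅_{Ω_conv,f} is defined only there; averages in conv Ω_I but outside its interior are thereby excluded. *)

(* Defs.v *)
From HB Require Import structures.
From mathcomp Require Import all_boot all_order all_algebra.
From mathcomp Require Import all_classical all_reals all_analysis.
Set Implicit Arguments. Unset Strict Implicit. Unset Printing Implicit Defensive.
Import Order.TTheory GRing.Theory Num.Theory.
Import numFieldNormedType.Exports.
Local Open Scope classical_set_scope.
Local Open Scope ring_scope.

Section Defs.
Context {R : realType} {d : nat}.
Local Notation V := 'rV[R]_d.

Definition dotv (a x : V) : R := \sum_(i < d) a 0 i * x 0 i.

Definition convex (A : set V) : Prop :=
  forall (x y : V) (t : R), A x -> A y -> 0 <= t <= 1 -> A (t *: x + (1 - t) *: y).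

Definition convhull (A : set V) : set V :=
  [set x | forall C : set V, convex C -> A `<=` C -> C x].

Definition bdry (A : set V) : set V := closure A `\` interior A.

Definition strictly_convex_open (A : set V) : Prop :=
  [/\ A !=set0, open A, convex A &
      forall (x y : V) (t : R), closure A x -> closure A y -> x != y ->
        0 < t < 1 -> A (t *: x + (1 - t) *: y)].

Definition is_ray (S : set V) : Prop :=
  exists (x e : V), e != 0 /\ S = [set x + t *: e | t in [set t : R | 0 <= t]].

(* directions of rays contained in A (maximal inscribed cone) *)
Definition ray_dirs (A : set V) : set V :=
  [set e | e != 0 /\ exists x : V, forall t : R, 0 <= t -> A (x + t *: e)].

Definition components (U : set V) : set (set V) :=
  [set C | exists x, U x /\ C = connected_component U x].

Definition supporting_hyperplane (A : set V) (a : V) (c : R) : Prop :=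
  [/\ a != 0, (forall y, A y -> dotv a y <= c) &
      exists y, closure A y /\ dotv a y = c].

Definition hyperplane (a : V) (c : R) : set V := [set y | dotv a y = c].

Definition standing_assumptions (OmO OmI : set V) : Prop :=
  [/\ (* (1) *) ~ (exists S, is_ray S /\ S `<=` bdry (convhull OmI)),
      (* (2) *) closure (convhull OmI) `<=` OmO,
      (* (3) *) interior (convhull OmI) !=set0 /\ ray_dirs OmO = ray_dirs (convhull OmI),
      (* (4) *) (forall B : set V, bounded_set B ->
                  finite_set [set C | components (interior (convhull OmI) `\` OmI) C
                                      /\ C `&` B !=set0]) &
      (* (5) *) (forall C, components (interior (convhull OmI) `\` OmI) C ->
                  exists (a : V) (c : R), supporting_hyperplane (convhull OmI) a c /\
                    bdry C `\` OmI `<=` hyperplane a c)].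

Definition Omega (OmO OmI : set V) : set V := closure OmO `\` OmI.
Definition Omega_conv (OmO OmI : set V) : set V := closure OmO `\` convhull OmI.

Definition avg (psi : R -> V) (a b : R) : V :=
  \row_i ((b - a)^-1 *
     fine (\int[lebesgue_measure]_(x in `[a, b]) (psi x 0 i)%:E)%E).

Definition A_Omega (OmO OmI : set V) (psi : R -> V) : Prop :=
  [/\ (forall i : 'I_d,
         lebesgue_measure.-integrable `[0, 1] (fun x => (psi x 0 i)%:E)),
      (forall x : R, 0 <= x <= 1 -> bdry OmO (psi x)) &
      (forall a b : R, 0 <= a -> a < b -> b <= 1 -> ~ OmI (avg psi a b))].

(* concavity of an extended-real valued function on C (hypograph is convex) *)
Definition concave_on (C : set V) (G : V -> \bar R) : Prop :=
  forall (x y : V) (t s u : R), C x -> C y -> 0 <= t <= 1 ->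
    (s%:E <= G x)%E -> (u%:E <= G y)%E ->
    (((t * s + (1 - t) * u)%R)%:E <= G (t *: x + (1 - t) *: y)%R)%E.

Definition locally_concave (D : set V) (G : V -> \bar R) : Prop :=
  forall C : set V, convex C -> C `<=` D -> concave_on C G.

(* the minimal locally concave function B_{D,f} (values of G outside D are irrelevant) *)
Definition Bfrak (OmO D : set V) (f : V -> R) (x : V) : \bar R :=
  ereal_inf [set G x | G in [set G : V -> \bar R |
     locally_concave D G /\ forall y, bdry OmO y -> G y = (f y)%:E]].

End Defs.

(* Main.v *)
(** Write K = conv Ω_I and X(s, t) for the average of ψ over [s, t], and let G be a competitor
    in the definition of the minimal function. If X(s, t) is outside K, one looks for u in
    (s, t) such that the segment [X(s, u), X(u, t)] misses K; concavity of G along it gives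
    (u - s) G(X(s, u)) + (t - u) G(X(u, t)) <= (t - s) G(X(s, t)).
    If u can be kept at distance at least κ(ε) from s and t whenever t - s >= ε, iterating
    yields partitions of [0, 1] of mesh < ε whose averages avoid K, and Lebesgue
    differentiation, the lower semicontinuity of G at ∂Ω_O and Fatou's lemma give the claim
    as ε tends to 0.

    By compactness it suffices to find κ near each interval [s0, t0]. This is easy if
    X(s0, t0) is outside K and vacuous if it is interior to K. Suppose that it lies on ∂K. It is
    not in Ω_I, hence it is in the closure of some ω_j, and by assumption (5) K coincides near it
    with a half-space {a <= c}, while cl ω_j minus Ω_I is open and closed in {a <= c} minus Ω_I.
    Let H(u) be the integral of a·ψ - c over [s0, u], so that H(s0) = H(t0). If H <= H(s0) on
    [s0, t0], the averages over suitable shrinking intervals stay in {a <= c} minus Ω_I, hence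
    in cl ω_j, and converge to some ψ(p) on ∂Ω_O, which is impossible. So H takes values on both
    sides of H(s0), and an interval close to [s0, t0] whose average is outside K can be cut at
    a point for which both averages lie in {a > c}. *)

Require Import Defs.
From HB Require Import structures.
From mathcomp Require Import all_boot all_order all_algebra finmap.
From mathcomp Require Import all_classical all_reals all_analysis measurable_realfun.
From mathcomp Require Import ring lra.
Import Order.TTheory GRing.Theory Num.Theory.
Import numFieldNormedType.Exports.
Local Open Scope classical_set_scope.
Local Open Scope ring_scope.
Set Implicit Arguments.
Unset Strict Implicit.
Unset Printing Implicit Defensive.

(** * Linear functionals and convex sets *)

Section Dot.
Context {R : realType} {d : nat}.
Local Notation V := 'rV[R]_d.
Implicit Types (a b x y : V) (A C : set V) (t : R).

(** No regularity of [G] is given; what is needed comes from chords. A supporting hyperplane of K,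
    translated to a point x of Ω_O outside K, misses K. By (1) and (3) none of its directions is a
    ray direction of Ω_O, so x lies on a chord that avoids K and ends on ∂Ω_O; concavity gives G(x)
    >= inf f. Near a point of ∂Ω_O strict convexity makes such chords short, whence the lower
    semicontinuity. Since G may be +oo, it is truncated at a level that grows as the mesh shrinks.
    These chords need d >= 2. For d = 1 the averages cannot jump over a point of Ω_I, and ψ turns
    out to be constant almost everywhere. The splitting argument uses that K is closed, which a hull
    of a closed set need not be; here it follows from (1) and (5). Finally, the point p to which the
    intervals shrink must be a running extremum of H and also a point of differentiability of the
    primitive of ψ. An extremum of H itself may fall into the exceptional null set, so one takes an
    extremum of a perturbation of H that increases strictly at every exceptional point. *)

Lemma dotvC a b : dotv a b = dotv b a.
Proof. by apply: eq_bigr => i _; rewrite mulrC. Qed.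

Lemma dotvDr a x y : dotv a (x + y) = dotv a x + dotv a y.
Proof. by rewrite -big_split; apply: eq_bigr => i _; rewrite mxE mulrDr. Qed.

Lemma dotvZr a t x : dotv a (t *: x) = t * dotv a x.
Proof. by rewrite mulr_sumr; apply: eq_bigr => i _; rewrite mxE mulrCA. Qed.

Lemma dotvNr a x : dotv a (- x) = - dotv a x.
Proof. by rewrite -scaleN1r dotvZr mulN1r. Qed.

Lemma dotvBr a x y : dotv a (x - y) = dotv a x - dotv a y.
Proof. by rewrite dotvDr dotvNr. Qed.

Lemma dotvDl a x y : dotv (x + y) a = dotv x a + dotv y a.
Proof. by rewrite !(dotvC _ a) dotvDr. Qed.

Lemma dotvZl a t x : dotv (t *: x) a = t * dotv x a.
Proof. by rewrite !(dotvC _ a) dotvZr. Qed.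

Lemma dotvNl a x : dotv (- x) a = - dotv x a.
Proof. by rewrite !(dotvC _ a) dotvNr. Qed.

Definition dotE := (dotvDr, dotvDl, dotvNr, dotvNl, dotvZr, dotvZl).

Lemma dotv_gt0 a : a != 0 -> 0 < dotv a a.
Proof.
move=> a0; rewrite lt_def sumr_ge0 ?andbT; last by move=> i _; rewrite -expr2 sqr_ge0.
apply: contra a0; rewrite psumr_eq0; last by move=> i _; rewrite -expr2 sqr_ge0.
move=> /allP h; apply/eqP/rowP => i; rewrite mxE.
by have := h i (mem_index_enum _); rewrite mulf_eq0 orbb => /eqP.
Qed.

(** The norm of ['rV[R]_d] is the maximum norm, so balls are cubes; the Euclidean length enters only
    as [dotv x x]. *)
Lemma coord_le_norm x i : `|x 0 i| <= `|x|.
Proof.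
rewrite [leRHS]/Num.norm /= mx_normrE.
by apply/bigmax_geP; right => /=; exists (0, i).
Qed.

Lemma norm_le_coord x (e : R) : 0 <= e -> (forall i, `|x 0 i| <= e) -> `|x| <= e.
Proof.
move=> e0 h; rewrite [X in X <= _]/Num.norm /= mx_normrE.
by apply/bigmax_leP; split => // -[i j] _ /=; rewrite (ord1 i).
Qed.

Lemma dotv_le_norm a x : `|dotv a x| <= (\sum_i `|a 0 i|) * `|x|.
Proof.
rewrite (le_trans (ler_norm_sum _ _ _))// mulr_suml ler_sum// => i _.
by rewrite normrM ler_wpM2l// coord_le_norm.
Qed.

Lemma nbhs_dist x (P : set V) :
  nbhs x P <-> exists2 r : R, 0 < r & forall y, `|x - y| < r -> P y.
Proof.
split => [/nbhs_ballP[r r0 h]|[r r0 h]]; [exists r => // y|apply/nbhs_ballP; exists r => // y].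
  by move=> xy; apply: h; rewrite -ball_normE.
by rewrite -ball_normE; exact: h.
Qed.

Lemma dotv_continuous a : continuous (dotv a).
Proof.
move=> x; apply/(@cvgrPdist_lt R R^o V (nbhs x)) => e e0.
have s0 : 0 < 1 + \sum_i `|a 0 i| by rewrite ltr_pwDl// sumr_ge0.
apply/nbhs_dist; exists (e / (1 + \sum_i `|a 0 i|)); first by rewrite divr_gt0.
move=> y; rewrite ltr_pdivlMr// -dotvBr mulrC; apply: le_lt_trans.
by rewrite (le_trans (dotv_le_norm _ _))// ler_wpM2r// lerDr.
Qed.

Lemma near_dotv_lt a x (c : R) : dotv a x < c -> \forall y \near x, dotv a y < c.
Proof. by move=> axc; apply: (@cvgr_lt R V (nbhs x) _ (dotv a) (dotv a x)) => //; exact: dotv_continuous. Qed.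

Lemma near_dotv_gt a x (c : R) : c < dotv a x -> \forall y \near x, c < dotv a y.
Proof. by move=> axc; apply: (@cvgr_gt R V (nbhs x) _ (dotv a) (dotv a x)) => //; exact: dotv_continuous. Qed.

Lemma closed_dotv_le a (c : R) : closed [set x | dotv a x <= c].
Proof.
rewrite (_ : mkset _ = dotv a @^-1` [set t | t <= c])//.
by apply: preimage_closed; [move=> ? _; exact: dotv_continuous | exact: closed_le].
Qed.

Lemma closed_dotv_eq a (c : R) : closed [set x | dotv a x = c].
Proof.
rewrite (_ : mkset _ = dotv a @^-1` [set t | t = c])//.
by apply: preimage_closed; [move=> ? _; exact: dotv_continuous | exact: closed_eq].
Qed.

Lemma closure_dist A x :
  closure A x <-> forall r : R, 0 < r -> exists2 y, A y & `|x - y| < r.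
Proof.
split => [cl r r0|h B /nbhs_dist[r r0 rB]].
  have [|y [Ay By]] := cl [set y | `|x - y| < r]; last by exists y.
  by apply/nbhs_dist; exists r.
by have [y Ay xy] := h r r0; exists y; split => //; exact: rB.
Qed.

Lemma closure_dotv_le A a (c : R) :
  (forall x, A x -> dotv a x <= c) -> forall x, closure A x -> dotv a x <= c.
Proof.
move=> h x /(closureS (B := [set x | dotv a x <= c]) h).
by rewrite -(closure_id _).1//; exact: closed_dotv_le.
Qed.

Lemma interior_dotv_lt A a (c : R) : a != 0 ->
  (forall x, A x -> dotv a x <= c) -> forall x, interior A x -> dotv a x < c.
Proof.
move=> a0 h x /nbhs_dist[r r0 xA].
have na : 0 < `|a| by rewrite normr_gt0.
have /h : A (x + (r / 2 / `|a|) *: a).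
  apply: xA; rewrite opprD addNKr normrN normrZ.
  rewrite ger0_norm ?divr_ge0 ?ltW// ?divr_gt0// divfK ?gt_eqF//; lra.
rewrite dotvDr dotvZr; apply: lt_le_trans.
by rewrite ltrDl mulr_gt0// ?dotv_gt0// !divr_gt0.
Qed.

End Dot.

Section Convex.
Context {R : realType} {d : nat}.
Local Notation V := 'rV[R]_d.
Implicit Types (a b x y : V) (A C : set V) (t : R).

Lemma convex_line A x v t1 t t2 : Defs.convex A -> t1 <= t <= t2 ->
  A (x + t1 *: v) -> A (x + t2 *: v) -> A (x + t *: v).
Proof.
move=> cA /andP[]; rewrite le_eqVlt => /predU1P[<-//|t1t].
rewrite le_eqVlt => /predU1P[->//|tt2] A1 A2.
have h : 0 < t2 - t1 by rewrite subr_gt0 (lt_trans t1t).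
have h01 : 0 <= (t2 - t) / (t2 - t1) <= 1.
  by rewrite ler_pdivrMr// divr_ge0 /=; lra.
have := cA _ _ _ A1 A2 h01; congr (A _).
apply/rowP => i; rewrite !mxE; field; rewrite gt_eqF//; lra.
Qed.

Lemma convexI A C : Defs.convex A -> Defs.convex C -> Defs.convex (A `&` C).
Proof. by move=> cA cC x y t [Ax Cx] [Ay Cy] t01; split; [exact: cA|exact: cC]. Qed.

Lemma convex_convhull A : Defs.convex (convhull A).
Proof. by move=> x y t hx hy t01 C cC AC; apply: (cC) => //; [exact: hx|exact: hy]. Qed.

Lemma sub_convhull A : A `<=` convhull A.
Proof. by move=> x Ax C _; exact. Qed.

Lemma convhull_sub A C : Defs.convex C -> A `<=` C -> convhull A `<=` C.
Proof. by move=> cC AC x; exact. Qed.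

Lemma convex_comb_lt (p q c t : R) : p < c -> q < c -> 0 <= t <= 1 ->
  t * p + (1 - t) * q < c.
Proof.
move=> pc qc /andP[]; rewrite le_eqVlt => /predU1P[<- _|t0 t1].
  by rewrite mul0r add0r subr0 mul1r.
have : t * p < t * c by rewrite ltr_pM2l.
have : (1 - t) * q <= (1 - t) * c by rewrite ler_wpM2l ?subr_ge0// ltW.
lra.
Qed.

Lemma convex_dotv_lt a (c : R) : Defs.convex [set x | dotv a x < c].
Proof. by move=> x y t /= hx hy t01; rewrite !dotE convex_comb_lt. Qed.

Lemma convex_dotv_eq a (c : R) : Defs.convex [set x | dotv a x = c].
Proof. by move=> x y t /= hx hy /andP[t0 t1]; rewrite !dotE; nra. Qed.

Lemma convex_ball x (r : R) : Defs.convex [set y | `|x - y| < r].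
Proof.
move=> y z t /= hy hz /andP[t0 t1].
have -> : x - (t *: y + (1 - t) *: z) = t *: (x - y) + (1 - t) *: (x - z).
  by apply/rowP => i; rewrite !mxE; ring.
rewrite (le_lt_trans (ler_normD _ _))// !normrZ !ger0_norm ?subr_ge0//.
by rewrite convex_comb_lt ?t0.
Qed.

Lemma convex_closure A : Defs.convex A -> Defs.convex (closure A).
Proof.
move=> cA x y t /closure_dist hx /closure_dist hy /andP[t0 t1].
apply/closure_dist => r r0.
have [x' Ax xx] := hx _ r0; have [y' Ay yy] := hy _ r0.
exists (t *: x' + (1 - t) *: y'); first by apply: cA => //; rewrite t0 t1.
have -> : t *: x + (1 - t) *: y - (t *: x' + (1 - t) *: y') =
    t *: (x - x') + (1 - t) *: (y - y').
  by apply/rowP => i; rewrite !mxE; ring.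
rewrite (le_lt_trans (ler_normD _ _))// !normrZ !ger0_norm ?subr_ge0//.
by rewrite convex_comb_lt ?t0.
Qed.

(** Replace [y] by a nearby [y'] of [A]. A point [z] near the combination is
    [t *: w + (1 - t) *: y'], and [w] is within [r] of [x] because the errors from [z] and from [y']
    are each below [t * r / 2]. *)
Lemma interior_closure_segment A x y t : Defs.convex A ->
  interior A x -> closure A y -> 0 < t <= 1 -> interior A (t *: x + (1 - t) *: y).
Proof.
move=> cA /nbhs_dist[r r0 xA] /closure_dist hy /andP[t0 t1].
have [t1'|t1'] := eqVneq t 1.
  apply/nbhs_dist; exists r => //; move=> z; rewrite t1' subrr scale0r addr0 scale1r.
  exact: xA.
have s0 : 0 < 1 - t by rewrite subr_gt0 lt_neqAle t1'.
have [|y' Ay yy] := hy (t * r / 2 / (1 - t)); first by rewrite !divr_gt0 ?mulr_gt0.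
apply/nbhs_dist; exists (t * r / 2); first by rewrite divr_gt0// mulr_gt0.
move=> z hz.
pose w := t^-1 *: (z - (1 - t) *: y').
have -> : z = t *: w + (1 - t) *: y'.
  by rewrite scalerA divff ?gt_eqF// scale1r subrK.
apply: cA => //; last by rewrite ltW.
apply: xA; rewrite -(ltr_pM2l t0) -[X in X * _](gtr0_norm t0) -normrZ scalerBr.
rewrite scalerA divff ?gt_eqF// scale1r.
have -> : t *: x - (z - (1 - t) *: y') =
  (t *: x + (1 - t) *: y - z) - (1 - t) *: (y - y').
  by apply/rowP => i; rewrite !mxE; ring.
rewrite (le_lt_trans (ler_normB _ _))// normrZ gtr0_norm//.
move: yy; rewrite ltr_pdivlMr// mulrC => yy; lra.
Qed.

Lemma convex_interior A : Defs.convex A -> Defs.convex (interior A).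
Proof.
move=> cA x y t hx hy /andP[t0 t1].
have [->|t0'] := eqVneq t 0; first by rewrite scale0r subr0 scale1r add0r.
apply: interior_closure_segment => //; last by rewrite lt_def t0' t0.
by apply: subset_closure; exact: interior_subset.
Qed.

Lemma closure_interior A p : Defs.convex A -> interior A p ->
  closure A `<=` closure (interior A).
Proof.
move=> cA Ap x Ax; apply/closure_dist => r r0.
pose t := Num.min 1 (r / 2 / (1 + `|x - p|)).
have n0 : 0 < 1 + `|x - p| by rewrite ltr_pwDl.
have t0 : 0 < t by rewrite lt_min ltr01 !divr_gt0.
exists (t *: p + (1 - t) *: x).
  by apply: interior_closure_segment => //; rewrite t0 ge_min lexx.
have -> : x - (t *: p + (1 - t) *: x) = t *: (x - p).
  by apply/rowP => i; rewrite !mxE; ring.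
rewrite normrZ gtr0_norm//.
apply: (@le_lt_trans _ _ (t * (1 + `|x - p|))).
  by rewrite ler_pM2l// lerDr.
have : t * (1 + `|x - p|) <= r / 2 by rewrite -ler_pdivlMr// ge_min lexx orbT.
lra.
Qed.

(** The weights are normalised only in the conclusion, so that the induction hypothesis applies to
    the tail; a tail of total weight 0 is treated apart. *)
Lemma convex_sum A n (l : 'I_n -> R) (p : 'I_n -> V) : Defs.convex A ->
  (forall i, 0 <= l i) -> (forall i, A (p i)) -> 0 < \sum_i l i ->
  A ((\sum_i l i)^-1 *: \sum_i l i *: p i).
Proof.
move=> cA; elim: n l p => [l p _ _|n ih l p l0 Ap]; first by rewrite big_ord0 ltxx.
rewrite !big_ord_recl /=.
have := ih (fun i => l (lift ord0 i)) (fun i => p (lift ord0 i)) (fun=> l0 _) (fun=> Ap _).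
set s := \sum_i l _; set v := \sum_i _ *: _ => hs ls.
have : 0 <= s by exact: sumr_ge0.
rewrite le_eqVlt => /predU1P[s0|s0].
  have -> : v = 0.
    apply: big1 => i _; suff -> : l (lift ord0 i) = 0 by rewrite scale0r.
    by apply/eqP; move: (esym s0) i => /psumr_eq0P h i; rewrite h.
  rewrite addr0 -s0 addr0 scalerA mulVf ?scale1r//.
  by rewrite -s0 addr0 in ls; rewrite gt_eqF.
have l00 := l0 ord0.
have := cA (p ord0) _ (l ord0 / (l ord0 + s)) (Ap ord0) (hs s0).
have h01 : 0 <= l ord0 / (l ord0 + s) <= 1.
  by rewrite ler_pdivrMr// divr_ge0 /=; lra.
move=> /(_ h01).
congr (A _); apply/rowP => i; rewrite !mxE; field.
by rewrite !gt_eqF.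
Qed.

End Convex.

(** * Separation *)

Section Separation.
Context {R : realType} {d : nat}.
Local Notation V := 'rV[R]_d.
Implicit Types (a b x y : V) (A C : set V) (t : R).

Lemma bounded_compact n (A : set 'rV[R]_n) (M : R) : closed A ->
  (forall u, A u -> `|u| <= M) -> compact A.
Proof.
move=> cA AM; apply: bounded_closed_compact => //.
by exists M; split; [exact: num_real|move=> N MN u /AM /le_trans; apply; exact: ltW].
Qed.

Lemma compact_sphere : compact [set b : V | `|b| = 1].
Proof.
apply: (@bounded_compact _ _ 1) => [|x ->//].
rewrite (_ : mkset _ = Num.norm @^-1` [set t | t = 1])//.
by apply: preimage_closed; [move=> x _; exact: norm_continuous|exact: closed_eq].
Qed.

Lemma compact_simplex n :
  compact [set l : 'rV[R]_n | (forall i, 0 <= l 0 i) /\ \sum_i l 0 i = 1].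
Proof.
apply: (@bounded_compact _ _ 1).
  rewrite (_ : mkset _ = (\bigcap_(i in [set: 'I_n]) [set l : 'rV[R]_n | dotv (- delta_mx 0 i) l <= 0])
     `&` [set l : 'rV[R]_n | dotv (const_mx 1) l = 1]); last first.
    apply/seteqP; split => l /= [h1 h2]; split.
    - move=> i _ /=; rewrite dotvNl oppr_le0 /dotv (bigD1 i)//= big1 ?addr0.
        by rewrite mxE !eqxx mul1r.
      by move=> j ji; rewrite mxE (negPf ji) andbF mul0r.
    - by rewrite -[RHS]h2; apply: eq_bigr => i _; rewrite mxE mul1r.
    - move=> i; have := h1 i I; rewrite /= dotvNl oppr_le0 /dotv (bigD1 i)//= big1 ?addr0.
        by rewrite mxE !eqxx mul1r.
      by move=> j ji; rewrite mxE (negPf ji) andbF mul0r.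
    - by rewrite -[RHS]h2; apply: eq_bigr => i _; rewrite mxE mul1r.
  apply: closedI; last exact: closed_dotv_eq.
  by apply: closed_bigI => i _; exact: closed_dotv_le.
move=> l [l0 l1]; apply: norm_le_coord => // i.
by rewrite ger0_norm// -l1 (bigD1 i)//= lerDl sumr_ge0.
Qed.

Lemma dotv_sqrD a b t :
  dotv (a + t *: b) (a + t *: b) = dotv a a + 2 * t * dotv a b + t * t * dotv b b.
Proof. by rewrite !dotE (dotvC b); ring. Qed.

(** Let [v l] be the convex combination of the [p i] with weights [l], minus [x], of least Euclidean
    length. It is nonzero as [x] is not in [A], and moving the weights towards a vertex cannot
    shorten it, so [- v l] separates. *)
Lemma finite_separation n (p : 'I_n -> V) A x : (0 < n)%N -> Defs.convex A ->
  (forall i, A (p i)) -> ~ A x ->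
  exists2 b, b != 0 & forall i, dotv b (p i - x) < 0.
Proof.
move=> n0 cA Ap Ax.
pose Lam := [set l : 'rV[R]_n | (forall i, 0 <= l 0 i) /\ \sum_i l 0 i = 1].
pose v (l : 'rV[R]_n) : V := \sum_i l 0 i *: p i - x.
pose q l := dotv (v l) (v l).
have cq : continuous q.
  rewrite /q /dotv; apply: continuous_big; first exact: add_continuous.
  move=> j _ l.
  have cv : {for l, continuous (fun l => v l 0 j)}.
    have -> : (fun l => v l 0 j) = (fun l => dotv (\row_i p i 0 j) l - x 0 j).
      apply/funext => k; rewrite !mxE summxE; congr (_ - _).
      by apply: eq_bigr => i _; rewrite !mxE mulrC.
    by apply: continuousB; [exact: dotv_continuous|exact: cst_continuous].
  exact: continuousM.
have Lam0 : Lam !=set0.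
  exists (delta_mx 0 (Ordinal n0)); split=> [i|]; first by rewrite mxE ler0n.
  rewrite (bigD1 (Ordinal n0))//= big1 ?addr0; first by rewrite mxE !eqxx.
  by move=> i ni; rewrite mxE (negPf ni) andbF.
have [l /set_mem[l0 l1] lmin] := EVT_min_rV Lam0 (@compact_simplex n) (continuous_subspaceT cq).
have vl0 : v l != 0.
  apply/eqP => vl; apply: Ax.
  have := @convex_sum _ _ A _ (fun i => l 0 i) p cA l0 Ap.
  rewrite l1 => /(_ ltr01); rewrite invr1 scale1r.
  by move/eqP: vl; rewrite subr_eq0 => /eqP ->.
exists (- v l); first by rewrite oppr_eq0.
move=> i; rewrite dotvNl oppr_lt0.
have vv := dotv_gt0 vl0.
rewrite ltNge; apply/negP => vi.
pose w := p i - x - v l.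
have vw : dotv (v l) w < 0 by rewrite dotvBr; lra.
(* With this [t] the quadratic term [t * t * dotv w w] is smaller than [- t * dotv (v l) w], so the
   negative linear term wins. *)
pose t := Num.min 1 (- dotv (v l) w / (1 + dotv w w)).
have ww : 0 <= dotv w w by apply: sumr_ge0 => j _; rewrite -expr2 sqr_ge0.
have t0 : 0 < t by rewrite lt_min ltr01 divr_gt0 ?oppr_gt0//; lra.
have t1 : t <= 1 by rewrite ge_min lexx.
have tw : t * (1 + dotv w w) <= - dotv (v l) w.
  by rewrite -ler_pdivlMr ?ge_min ?lexx ?orbT//; lra.
have : q l <= q ((1 - t) *: l + t *: delta_mx 0 i).
  apply: lmin; apply/mem_set; split=> [j|].
    rewrite !mxE eqxx /=; apply: addr_ge0; apply: mulr_ge0 => //; [lra|exact: ltW].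
  under eq_bigr do rewrite !mxE eqxx /=.
  rewrite big_split -!mulr_sumr l1 mulr1 (bigD1 i)//= big1 ?addr0.
    by rewrite eqxx mulr1 subrK.
  by move=> j ji; rewrite (negPf ji).
have -> : q ((1 - t) *: l + t *: delta_mx 0 i) =
    q l + 2 * t * dotv (v l) w + t * t * dotv w w.
  have -> : q ((1 - t) *: l + t *: delta_mx 0 i) = dotv (v l + t *: w) (v l + t *: w).
    rewrite /q; suff -> : v ((1 - t) *: l + t *: delta_mx 0 i) = v l + t *: w by [].
    rewrite /w /v; under eq_bigr do rewrite !mxE eqxx /= scalerDl -!scalerA.
    rewrite big_split /= -!scaler_sumr.
    rewrite [X in _ + t *: X - x](_ : _ = p i).
      by apply/rowP => j; rewrite !mxE; ring.
    rewrite (bigD1 i)//= eqxx scale1r big1 ?addr0//.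
    by move=> j ji; rewrite (negPf ji) scale0r.
  exact: dotv_sqrD.
have : t * (t * (1 + dotv w w)) <= t * (- dotv (v l) w) by rewrite ler_pM2l.
have : t * dotv (v l) w < 0 by rewrite pmulr_rlt0.
have : 0 < t * t by rewrite mulr_gt0.
lra.
Qed.

(** If every unit functional failed, each would be positive on [y - x] for some [y] in [A]. These
    are open conditions covering the compact sphere, so finitely many [y] suffice, contradicting
    [finite_separation] for them. *)
Lemma separation A x : (0 < d)%N -> Defs.convex A -> ~ A x ->
  exists2 b, b != 0 & forall y, A y -> dotv b y <= dotv b x.
Proof.
move=> d0 cA Ax; apply: contrapT => /forall2NP nob.
have hb b : `|b| = 1 -> exists2 y, A y & 0 < dotv b (y - x).
  move=> b1; case: (nob b) => [|/existsNP[y /not_implyP[Ay /negP]]].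
    by move/negP/negPn/eqP => b0; move: b1; rewrite b0 normr0 => /eqP; rewrite eq_sym oner_eq0.
  by rewrite -ltNge => h; exists y => //; rewrite dotvBr subr_gt0.
have := compact_sphere; rewrite compact_cover => /(_ V A (fun y => [set b | 0 < dotv b (y - x)])).
case.
- move=> y _; rewrite (_ : mkset _ = dotv (y - x) @^-1` [set t | 0 < t]).
    by apply: open_comp; [move=> ? _; exact: dotv_continuous|exact: open_gt].
  by apply/seteqP; split => b /=; rewrite dotvC.
- by move=> b /hb[y Ay h]; exists y.
move=> D DA Dcov.
pose s : seq V := enum_fset D.
pose p (i : 'I_(size s)) := s`_i.
have pD i : p i \in D by rewrite /p -[p i \in D]/(s`_i \in s) mem_nth.
have s0 : (0 < size s)%N.
  have [|y yD _] := Dcov (const_mx 1).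
    apply/eqP; rewrite eq_le; apply/andP; split.
      by apply: norm_le_coord => // i; rewrite mxE normr1.
    by have := coord_le_norm (const_mx 1 : V) (Ordinal d0); rewrite mxE normr1.
  have : y \in s by [].
  by case: s {p pD}.
have Ap i : A (p i) by have /DA := pD i; rewrite inE.
have [b b0 bp] := finite_separation s0 cA Ap Ax.
have nb : 0 < `|b| by rewrite normr_gt0.
have [|y yD /=] := Dcov (`|b|^-1 *: b).
  by rewrite /= normrZ normfV normr_id mulVf// gt_eqF.
rewrite dotvZl pmulr_rgt0 ?invr_gt0//.
have ys : y \in s by [].
have := bp (Ordinal (etrans (index_mem y s) ys)); rewrite /p/= nth_index//.
by move=> /lt_trans h /h; rewrite ltxx.
Qed.

(** Separate [x] from the [r]-neighbourhood of [A] instead: it contains [y + e *: b] for each [y] in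
    [A], which leaves a gap of [e * dotv b b]. *)
Lemma strict_separation A x : (0 < d)%N -> Defs.convex A -> closed A -> ~ A x ->
  exists b, exists2 c, (forall y, A y -> dotv b y <= c) & c < dotv b x.
Proof.
move=> d0 cA clA Ax.
have [r r0 rA] : exists2 r : R, 0 < r & forall y, `|x - y| < r -> ~ A y.
  by apply/nbhs_dist; apply: open_nbhs_nbhs; split => //; exact: closed_openC.
pose B := [set z | exists2 y, A y & `|y - z| < r].
have cB : Defs.convex B.
  move=> z1 z2 t [y1 Ay1 h1] [y2 Ay2 h2] t01.
  exists (t *: y1 + (1 - t) *: y2); first exact: cA.
  have -> : t *: y1 + (1 - t) *: y2 - (t *: z1 + (1 - t) *: z2) =
    t *: (y1 - z1) + (1 - t) *: (y2 - z2).
    by apply/rowP => i; rewrite !mxE; ring.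
  have /andP[t0 t1] := t01.
  rewrite (le_lt_trans (ler_normD _ _))// !normrZ !ger0_norm ?subr_ge0//.
  by rewrite convex_comb_lt.
have Bx : ~ B x by move=> [y Ay yx]; apply: (rA y) => //; rewrite distrC.
have [b b0 bB] := separation d0 cB Bx.
have nb : 0 < `|b| by rewrite normr_gt0.
pose e := r / 2 / `|b|.
have e0 : 0 < e by rewrite !divr_gt0.
exists b, (dotv b x - e * dotv b b).
  move=> y Ay; rewrite lerBrDr -dotvZr -dotvDr bB//.
  exists y => //; rewrite opprD addNKr normrN normrZ gtr0_norm// divfK ?gt_eqF//; lra.
by rewrite ltrBlDr ltrDl mulr_gt0// dotv_gt0.
Qed.

End Separation.

(** * Boundary crossings, rays in convex sets, and connectedness along paths *)

Section Boundary.
Context {R : realType} {d : nat}.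
Local Notation V := 'rV[R]_d.
Implicit Types (a b x y z v e : V) (A C U : set V) (t r c : R).

Lemma small_scale v r : 0 < r -> exists2 s : R, 0 < s & forall t, `|t| <= s -> `|t *: v| < r.
Proof.
move=> r0; have n0 : 0 < 1 + `|v| by rewrite ltr_pwDl.
exists (r / 2 / (1 + `|v|)); first by rewrite !divr_gt0.
move=> t; rewrite ler_pdivlMr// normrZ => ht.
have : `|t| * `|v| <= `|t| * (1 + `|v|) by rewrite ler_wpM2l// lerDr.
lra.
Qed.

Lemma bdry_open U y : open U -> bdry U y <-> closure U y /\ ~ U y.
Proof. by rewrite /bdry => /interior_id ->. Qed.

Lemma boundary_crossing U x v (T : R) : open U -> U x -> 0 <= T -> ~ U (x + T *: v) ->
  exists t, [/\ 0 <= t <= T, bdry U (x + t *: v) & forall s, 0 <= s < t -> U (x + s *: v)].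
Proof.
move=> oU Ux T0 UT.
pose Z := [set s : R | 0 <= s /\ ~ U (x + s *: v)].
have ZT : Z T by [].
have lbZ : lbound Z 0 by move=> s [].
have hZ : has_inf Z by split; [exists T|exists 0].
pose t := inf Z.
have t0 : 0 <= t by apply: lb_le_inf => //; exists T.
have tT : t <= T by apply: ge_inf => //; exists 0.
have Ut : ~ U (x + t *: v).
  move=> /(conj oU) /open_nbhs_nbhs /nbhs_dist[r r0 rU].
  have [s s0 hs] := small_scale v r0.
  have [z [z0 Uz] zt] := inf_adherent s0 hZ.
  have tz : t <= z by apply: ge_inf => //; exists 0.
  apply: Uz; apply: rU; rewrite opprD addrACA subrr add0r -scalerBl hs// ler0_norm; last lra.
  by rewrite opprB lerBlDl ltW.
exists t; split; first by rewrite t0 tT.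
  apply/bdry_open => //; split=> //; apply/closure_dist => r r0.
  have tp : 0 < t.
    by rewrite lt_def t0 andbT; apply/eqP => tz; apply: Ut; rewrite tz scale0r addr0.
  have [s s0 hs] := small_scale v r0.
  pose u := Num.max 0 (t - s).
  have ut : u < t by rewrite gt_max tp ltrBlDr ltrDl.
  exists (x + u *: v).
    apply: contrapT => Uu; have : t <= u; last by rewrite leNgt ut.
    by apply: ge_inf; [exists 0|split => //; rewrite le_max lexx].
  rewrite opprD addrACA subrr add0r -scalerBl hs// gtr0_norm ?subr_gt0//.
  by rewrite lerBlDr -lerBlDl le_max lexx orbT.
move=> s /andP[s0 st]; apply: contrapT => Us.
have : t <= s by apply: ge_inf; [exists 0|split].
by rewrite leNgt st.
Qed.

(** Without a ray from [x], every direction leaves [A], and by convexity for good. As [A] is closed,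
    the exit time is locally bounded in the direction, and compactness of the sphere yields one
    bound [T] for all. *)
Lemma bounded_or_ray A x : Defs.convex A -> closed A -> A x ->
  (exists M : R, forall y, A y -> `|y| <= M) \/
  (exists2 e, e != 0 & forall t, 0 <= t -> A (x + t *: e)).
Proof.
move=> cA clA Ax; have [?|noe] := pselect (exists2 e, e != 0 & forall t, 0 <= t -> A (x + t *: e)).
  by right.
left.
have [T [T0 hT]] : exists T : R, 0 < T /\ forall e, `|e| = 1 -> ~ A (x + T *: e).
  have /compact_near_coveringP/(_ R (+oo%R) (fun T e => ~ A (x + T *: e))) :=
    @compact_sphere R d.
  move=> /(_ _); case.
    move=> e /= e1.
    have [t t0 At] : exists2 t, 0 <= t & ~ A (x + t *: e).
      apply: contrapT => h; apply: noe; exists e => [|t t0].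
        by rewrite -normr_eq0 e1 oner_eq0.
      by apply: contrapT => At; apply: h; exists t.
    have [r r0 rA] : exists2 r : R, 0 < r & forall y, `|x + t *: e - y| < r -> ~ A y.
      by apply/nbhs_dist; apply: open_nbhs_nbhs; split => //; exact: closed_openC.
    have t1 : 0 < 1 + t by rewrite ltr_pwDl.
    exists ([set e' | `|e - e'| < r / (1 + t)], [set T | t < T]) => /=.
      split; first by apply/nbhs_dist; exists (r / (1 + t)) => //; rewrite divr_gt0.
      by apply: nbhs_pinfty_gt; exact: num_real.
    move=> [e' T] [/= ee tT] AT; apply: (rA (x + t *: e')).
      rewrite opprD addrACA subrr add0r -scalerBr normrZ ger0_norm//.
      move: ee; rewrite ltr_pdivlMr// mulrC; apply: le_lt_trans.
      by rewrite ler_wpM2r// lerDr.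
    apply: (@convex_line _ _ _ x e' 0 t T) => //; first by rewrite t0 ltW.
    by rewrite scale0r addr0.
  move=> M [_ hM]; exists (Num.max 0 M + 1); split.
    by rewrite ltr_pwDr// le_max lexx.
  by move=> e e1; apply: hM => //; rewrite ltr_pwDr// le_max lexx orbT.
exists (`|x| + T) => y Ay; rewrite leNgt; apply/negP => yT.
have xy : T < `|y - x|.
  by rewrite -(ltrD2l `|x|) (lt_le_trans yT)// -[X in `|X| <= _](subrKC x) ler_normD.
have n0 : 0 < `|y - x| by rewrite (lt_trans T0).
apply: (hT (`|y - x|^-1 *: (y - x))).
  by rewrite normrZ normfV normr_id mulVf ?gt_eqF.
rewrite scalerA; apply: (@convex_line _ _ _ x (y - x) 0 _ 1) => //.
- by rewrite ler_pdivrMr// mul1r divr_ge0 ?ltW.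
- by rewrite scale0r addr0.
- by rewrite scale1r subrKC.
Qed.

Lemma orthogonal_vector a : (1 < d)%N -> exists2 b, b != 0 & dotv a b = 0.
Proof.
case: d a => [|[|n]]// a _.
pose i0 : 'I_n.+2 := ord0; pose i1 : 'I_n.+2 := lift ord0 ord0.
have dd (i : 'I_n.+2) : dotv a (delta_mx 0 i) = a 0 i.
  rewrite /dotv (bigD1 i)//= big1 ?addr0; first by rewrite mxE !eqxx mulr1.
  by move=> j ji; rewrite mxE (negPf ji) andbF mulr0.
have [a0|a0] := eqVneq (a 0 i0) 0.
  exists (delta_mx 0 i0); last by rewrite dd.
  by apply/eqP => /matrixP/(_ 0 i0)/eqP; rewrite !mxE !eqxx oner_eq0.
exists (a 0 i0 *: delta_mx 0 i1 - a 0 i1 *: delta_mx 0 i0).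
  apply/eqP => /matrixP/(_ 0 i1)/eqP; rewrite !mxE !eqxx /= mulr0 mulr1 subr0.
  by rewrite (negPf a0).
by rewrite !dotE !dd; ring.
Qed.

Lemma continuous_dist (T : topologicalType) (g : T -> V) (u : T) :
  (forall r, 0 < r -> \forall w \near u, `|g u - g w| < r) -> g @ u --> g u.
Proof.
by move=> h A /nbhs_dist[r r0 rA]; apply: filterS (h r r0) => w; exact: rA.
Qed.

Lemma continuous_line x v : continuous (fun t : R => x + t *: v).
Proof.
move=> t; apply: continuous_dist => r r0.
have [s s0 hs] := small_scale v r0.
near=> w; rewrite opprD addrACA subrr add0r -scalerBl hs//.
Unshelve. all: by end_near. Qed.

Lemma segment_component U x y : (forall t, 0 <= t <= 1 -> U (x + t *: (y - x))) ->
  connected_component U x y.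
Proof.
move=> h; pose g (t : R) : V := x + t *: (y - x).
have cg : continuous g by exact: continuous_line.
apply: (@connected_component_max _ U (g @` `[0, 1])).
- by exists 0; [rewrite /= in_itv/= lexx ler01|rewrite /g scale0r addr0].
- by move=> _ [t /= + <-]; rewrite in_itv/= => /h.
- apply: connected_continuous_connected; first exact: segment_connected.
  exact: continuous_subspaceT.
- by exists 1; [rewrite /= in_itv/= lexx ler01|rewrite /g scale1r subrKC].
Qed.

Lemma interval_clopen (P : R -> Prop) (s t : R) :
  (forall u, s <= u <= t -> P u -> \forall w \near u, s <= w <= t -> P w) ->
  (forall u, s <= u <= t -> ~ P u -> \forall w \near u, s <= w <= t -> ~ P w) ->
  forall u w, s <= u <= t -> s <= w <= t -> P u -> P w.
Proof.
move=> hP hN u w su sw Pu.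
have := @segment_connected R s t [set v | s <= v <= t /\ P v].
suff h : forall B : set R, B = [set` `[s, t]] -> (B w -> P w) -> P w.
  move=> H; apply: (h _ (H _ _ _)) => //; last by case.
  - by exists u.
  - exists (interior [set v | s <= v <= t -> P v]); first exact: open_interior.
    apply/seteqP; split => v /=; rewrite in_itv/=.
      by move=> [sv Pv]; split => //; exact: hP.
    by move=> [sv /interior_subset/(_ sv)].
  - exists (~` interior [set v | s <= v <= t -> ~ P v]); first exact/open_closedC/open_interior.
    apply/seteqP; split => v /=; rewrite in_itv/=.
      by move=> [sv Pv]; split => // /interior_subset/(_ sv).
    by move=> [sv nv]; split => //; apply: contrapT => /(hN _ sv).
by move=> B -> ; apply; rewrite /= in_itv.
Qed.

End Boundary.

(** * The convex hull and its gaps *)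

Section Hull.
Context {R : realType} {d : nat}.
Local Notation V := 'rV[R]_d.
Variable OmI : set V.
Local Notation K := (convhull OmI).
Hypothesis clI : closed OmI.
Hypothesis intK : interior K !=set0.
Hypothesis compK : forall C, components (interior K `\` OmI) C ->
  exists (a : V) (c : R), supporting_hyperplane K a c /\ bdry C `\` OmI `<=` hyperplane a c.
Implicit Types (a b x y z v e : V) (C : set V) (t r c : R).

Lemma notin_ball x : ~ OmI x -> exists2 r, 0 < r & forall y, `|x - y| < r -> ~ OmI y.
Proof.
by move=> Ix; apply/nbhs_dist; apply: open_nbhs_nbhs; split => //; exact: closed_openC.
Qed.

Lemma component_sub C : components (interior K `\` OmI) C -> C `<=` interior K `\` OmI.
Proof. by move=> [x [_ ->]]; exact: connected_component_sub. Qed.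

(** The ball and [interior K] are convex, so the segment from [p] to [y] stays in both and avoids
    [OmI]. *)
Lemma component_ball C x r p y : components (interior K `\` OmI) C ->
  (forall y, `|x - y| < r -> ~ OmI y) -> C p -> `|x - p| < r ->
  interior K y -> `|x - y| < r -> C y.
Proof.
move=> [x0 [_ ->]] rI Cp xp Ky xy.
apply: (connected_component_trans Cp); apply: segment_component => t t01.
have -> : p + t *: (y - p) = t *: y + (1 - t) *: p.
  by apply/rowP => i; rewrite !mxE; ring.
have Kp : interior K p.
  by have [] := @connected_component_sub _ (interior K `\` OmI) x0 p Cp.
split; first by apply: (convex_interior (@convex_convhull _ _ OmI)).
by apply: rI; apply: (@convex_ball _ _ x r).
Qed.

Lemma component_bdry C y : components (interior K `\` OmI) C ->
  closure C y -> ~ interior K y -> bdry C y.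
Proof.
move=> hC Cy Ky; split => // /interior_subset /(component_sub hC)[].
by move=> /Ky.
Qed.

(** By [component_ball], a ball around [y] that avoids [OmI] meets a single component, so the points
    of [interior K] tending to [y] eventually belong to that one. *)
Lemma boundary_component y : closure K y -> ~ interior K y -> ~ OmI y ->
  exists2 C, components (interior K `\` OmI) C & closure C y.
Proof.
move=> Ky iKy Iy; have [r r0 rI] := notin_ball Iy.
have [p Kp] := intK.
have {}Ky := closure_interior (@convex_convhull _ _ OmI) Kp Ky.
have /closure_dist/(_ r r0)[q Kq yq] := Ky.
have Uq : (interior K `\` OmI) q by split => //; exact: rI.
exists (connected_component (interior K `\` OmI) q); first by exists q.
apply/closure_dist => r' r'0.
have /closure_dist/(_ (Num.min r r'))[|z Kz] := Ky; first by rewrite lt_min r0.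
rewrite lt_min => /andP[yz yz']; exists z => //.
apply: (@component_ball _ y r q) => //; first by exists q.
exact: connected_component_refl.
Qed.

(* Inside a ball that avoids [OmI], a point of [{a < c}] outside [int K] would be
   reached from the component through a boundary point lying in [{a < c}]. *)
Lemma component_local C a c z : components (interior K `\` OmI) C ->
  supporting_hyperplane K a c -> bdry C `\` OmI `<=` hyperplane a c ->
  closure C z -> ~ OmI z ->
  exists2 r, 0 < r & forall w, `|z - w| < r -> dotv a w <= c -> closure C w.
Proof.
move=> hC [a0 aK _] aC Cz Iz; have [r r0 rI] := notin_ball Iz.
have /closure_dist/(_ r r0)[p Cp zp] := Cz.
have Kp : interior K p by have [] := component_sub hC Cp.
have [Kz|Kz] := pselect (interior K z).
  have /nbhs_dist[r' r'0 r'K] : nbhs z (interior K).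
    by apply: open_nbhs_nbhs; split => //; exact: open_interior.
  exists (Num.min r r'); first by rewrite lt_min r0.
  move=> w; rewrite lt_min => /andP[zw zw'] _; apply: subset_closure.
  by apply: (component_ball hC rI Cp zp) => //; exact: r'K.
have lt_in w : `|z - w| < r -> dotv a w < c -> C w.
  move=> zw awc; apply: (component_ball hC rI Cp zp) => //.
  apply: contrapT => Kw.
  have ap := interior_dotv_lt a0 aK Kp.
  have [|t [t01 /(bdry_open _ (@open_interior _ K))[Ht nKt] lt_t]] :=
      @boundary_crossing _ _ (interior K) p (w - p) 1 (@open_interior _ _) Kp ler01.
    by rewrite scale1r subrKC.
  have conv s : p + s *: (w - p) = s *: w + (1 - s) *: p.
    by apply/rowP => i; rewrite !mxE; ring.
  have ball_t s : 0 <= s <= 1 -> `|z - (p + s *: (w - p))| < r.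
    by move=> s01; rewrite conv; apply: (@convex_ball _ _ z r).
  have : bdry C (p + t *: (w - p)).
    apply: component_bdry => //; apply/closure_dist => e e0.
    have [s s0 hs] := small_scale (w - p) e0.
    have /andP[t0 t1] := t01.
    have tp : 0 < t.
      by rewrite lt_def t0 andbT; apply/eqP => tz; apply: nKt; rewrite tz scale0r addr0.
    pose u := Num.max 0 (t - s).
    have u0 : 0 <= u by rewrite le_max lexx.
    have ut : u < t by rewrite gt_max tp ltrBlDr ltrDl.
    exists (p + u *: (w - p)).
      apply: (component_ball hC rI Cp zp); first by apply: lt_t; rewrite u0.
      by apply: ball_t; rewrite u0 (le_trans (ltW ut)).
    rewrite opprD addrACA subrr add0r -scalerBl hs// gtr0_norm ?subr_gt0//.
    by rewrite lerBlDr -lerBlDl le_max lexx orbT.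
  move=> bt; have := aC _ (conj bt (rI _ (ball_t _ t01))); rewrite /hyperplane /= conv.
  have := @convex_dotv_lt _ _ a c w p t awc ap t01.
  by move=> /= h1 h2; move: h1; rewrite h2 ltxx.
exists r => // w zw; rewrite le_eqVlt => /predU1P[awc|]; last first.
  by move=> /(lt_in _ zw); exact: subset_closure.
apply/closure_dist => e e0.
have [|s s0 hs] := @small_scale _ _ a (Num.min e (r - `|z - w|)).
  by rewrite lt_min e0 subr_gt0.
have hsa : `|s *: a| < Num.min e (r - `|z - w|) by apply: hs; rewrite gtr0_norm.
move: hsa; rewrite lt_min => /andP[h1 h2].
exists (w - s *: a); last by rewrite opprB addrCA subrr addr0.
apply: lt_in.
  rewrite opprB addrCA addrC (le_lt_trans (ler_normD _ _))//; lra.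
by rewrite dotvBr dotvZr awc ltrBlDr ltrDl mulr_gt0// dotv_gt0.
Qed.

(** [component_local] makes membership in [closure C] an open condition along the path, and it is a
    closed one anyway. *)
Lemma path_in_component C a c (g : R -> V) (s t : R) :
  components (interior K `\` OmI) C ->
  supporting_hyperplane K a c -> bdry C `\` OmI `<=` hyperplane a c ->
  (forall u, s <= u <= t -> {for u, continuous g}) ->
  (forall u, s <= u <= t -> dotv a (g u) <= c /\ ~ OmI (g u)) ->
  forall u w, s <= u <= t -> s <= w <= t -> closure C (g u) -> closure C (g w).
Proof.
move=> hC sup aC cg hg; apply: interval_clopen => u su Cu.
  have [r r0 hr] := component_local hC sup aC Cu (hg _ su).2.
  have : \forall w \near u, `|g u - g w| < r.
    apply: (cg u su [set y | `|g u - y| < r]); apply/nbhs_dist; by exists r.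
  by apply: filterS => w gw /hg[gwc _]; exact: hr.
have : nbhs (g u) (~` closure C).
  apply: open_nbhs_nbhs; split => //; apply: closed_openC; exact: closed_closure.
move=> /(cg u su) h; have {}h : \forall w \near u, ~ closure C (g w) by exact: h.
by apply: filterS h => w gw _.
Qed.

Lemma boundary_hyperplane y : closure K y -> ~ interior K y -> ~ OmI y ->
  exists C a c, [/\ components (interior K `\` OmI) C, supporting_hyperplane K a c,
   bdry C `\` OmI `<=` hyperplane a c, closure C y & dotv a y = c].
Proof.
move=> Ky iKy Iy; have [C hC Cy] := boundary_component Ky iKy Iy.
have [a [c [sup aC]]] := compK hC.
by exists C, a, c; split => //; apply: aC; split => //; exact: component_bdry.
Qed.

Lemma component_closure_sub C : components (interior K `\` OmI) C -> closure C `<=` closure K.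
Proof.
move=> hC; apply: closureS => x /(component_sub hC)[/interior_subset].
by [].
Qed.

Lemma supporting_bdry a c x : supporting_hyperplane K a c -> closure K x ->
  dotv a x = c -> bdry K x.
Proof.
move=> [a0 aK _] Kx axc; split => // /(interior_dotv_lt a0 aK).
by rewrite axc ltxx.
Qed.

(* The face [F = cl K ∩ {a = c}] through a point [x] of [cl K \ K] is compact.
   A functional [b] separating [x] from [F ∩ OmI] inside [{a = c}] attains its maximum
   over [F] at some [z] outside [OmI], and near [z] the face [F] is a full
   neighbourhood of [z] in [{a = c}]. *)
Lemma closed_hull : (1 < d)%N -> ~ (exists S, is_ray S /\ S `<=` bdry K) -> closed K.
Proof.
move=> d1 noray x Kx; apply: contrapT => nKx.
have iKx : ~ interior K x by move=> /interior_subset.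
have Ix : ~ OmI x by move=> /sub_convhull.
have [C [a [c [hC sup aC Cx axc]]]] := boundary_hyperplane Kx iKx Ix.
have [a0 aK _] := sup.
have aK' := closure_dotv_le aK.
pose F : set V := closure K `&` [set y | dotv a y = c].
have clF : closed F by apply: closedI; [exact: closed_closure|exact: closed_dotv_eq].
have cF : Defs.convex F.
  apply: convexI; last exact: convex_dotv_eq.
  by apply: convex_closure; exact: convex_convhull.
have Fx : F x by [].
have coF : compact F.
  have [[M FM]|[e e0 eF]] := bounded_or_ray cF clF Fx; first exact: bounded_compact clF FM.
  exfalso; apply: noray; exists [set x + t *: e | t in [set t : R | 0 <= t]]; split.
    by exists x, e.
  by move=> _ [t /= t0 <-]; have [Kt at_] := eF t t0; exact: supporting_bdry sup Kt at_.
have aa := dotv_gt0 a0.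
have [b [b0 ba bF]] : exists b, [/\ b != 0, dotv b a = 0 &
    forall y, F y -> OmI y -> dotv b y <= dotv b x].
  have [[k [Fk Ik]]|nk] := pselect (exists k, F k /\ OmI k); last first.
    have [b b0 ab] := orthogonal_vector a d1.
    exists b; split => //; first by rewrite dotvC.
    by move=> y Fy Iy; exfalso; apply: nk; exists y.
  pose H := convhull (F `&` OmI).
  (* The cylinder over [H] in the direction [a]: a functional bounded above on it must vanish on
     [a], which is the required [dotv b a = 0]. *)
  pose A : set V := [set y | exists s : R, H (y + s *: a)].
  have cA : Defs.convex A.
    move=> y1 y2 t [s1 H1] [s2 H2] t01; exists (t * s1 + (1 - t) * s2).
    have := convex_convhull H1 H2 t01; congr (H _).
    by apply/rowP => i; rewrite !mxE; ring.
  have HK : H `<=` K by apply: convhull_sub => [|y [_ /sub_convhull]//]; exact: convex_convhull.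
  have Hc : H `<=` [set y | dotv a y = c].
    by apply: convhull_sub => [|y [[]]//]; exact: convex_dotv_eq.
  have nAx : ~ A x.
    move=> [s Hs]; apply: nKx; have := Hc _ Hs; rewrite /= dotvDr dotvZr axc => hs.
    have s0 : s = 0.
      apply/eqP; have : s * dotv a a == 0 by apply/eqP; lra.
      by rewrite mulf_eq0 (gt_eqF aa) orbF.
    by move: Hs; rewrite s0 scale0r addr0 => /HK.
  have [b b0 bA] := separation (ltnW d1) cA nAx.
  have bk s : dotv b k - s * dotv b a <= dotv b x.
    rewrite -dotvZr -dotvBr; apply: bA; exists s; rewrite subrK.
    exact: sub_convhull.
  exists b; split => //.
    apply/eqP/negP => /negP ba.
    have := bk ((dotv b k - dotv b x - 1) / dotv b a).
    by rewrite divfK//; lra.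
  move=> y Fy Iy; apply: bA; exists 0; rewrite scale0r addr0.
  exact: sub_convhull.
have bb := dotv_gt0 b0.
have [z [Fz Iz zmax]] : exists z, [/\ F z, ~ OmI z & forall y, F y -> dotv b y <= dotv b z].
  have [|z /set_mem Fz zmax] := EVT_max_rV _ coF (continuous_subspaceT (@dotv_continuous _ _ b)).
    by exists x.
  have {}zmax y : F y -> dotv b y <= dotv b z by move=> Fy; apply: zmax; exact: mem_set.
  (* If the maximum is attained in [OmI], then [bF] bounds it by the value at [x], so [x] is a
     maximiser outside [OmI]. *)
  have [Iz|Iz] := pselect (OmI z); last by exists z.
  by exists x; split => // y /zmax /le_trans; apply; exact: bF.
have [Kz /= azc] := Fz.
have iKz : ~ interior K z by have [] := supporting_bdry sup Kz azc.
have [C' [a' [c' [hC' sup' aC' Cz' azc']]]] := boundary_hyperplane Kz iKz Iz.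
have [r r0 hr] := component_local hC' sup' aC' Cz' Iz.
have {}hr w : `|z - w| < r -> dotv a' w <= c' -> closure K w.
  by move=> zw aw; apply: component_closure_sub hC' _ _; exact: hr.
have [a'b|a'b] := leP (dotv a' b) 0.
  have [s s0 hs] := small_scale b r0.
  have Kw : closure K (z + s *: b).
    apply: hr; first by rewrite opprD addNKr normrN hs// gtr0_norm.
    by rewrite dotvDr dotvZr azc' gerDl mulr_ge0_le0// ltW.
  have /zmax : F (z + s *: b) by split => //=; rewrite dotvDr dotvZr azc dotvC ba mulr0 addr0.
  by rewrite dotvDr dotvZr gerDl leNgt mulr_gt0.
(* This direction satisfies [dotv a' v < 0], so a small step along it stays in [closure K], and
   [dotv a v > 0], so the step leaves the half-space [{a <= c}] that contains [closure K]. *)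
pose v := dotv a' b *: a - (1 + `|dotv a' a|) *: b.
have [s s0 hs] := small_scale v r0.
have Kw : closure K (z + s *: v).
  apply: hr; first by rewrite opprD addNKr normrN hs// gtr0_norm.
  rewrite dotvDr dotvZr azc' gerDl mulr_ge0_le0 ?(ltW s0)// /v !dotE.
  have := ler_norm (dotv a' a); nra.
have := aK' _ Kw; rewrite dotvDr dotvZr azc gerDl /v !dotE (dotvC a b) ba mulr0 subr0.
by rewrite leNgt !mulr_gt0.
Qed.

End Hull.

(** * Segments that avoid a closed set *)

Section Segments.
Context {R : realType} {d : nat}.
Local Notation V := 'rV[R]_d.

Definition avoids (K : set V) (p q : V) := forall t : R, 0 <= t <= 1 -> ~ K (p + t *: (q - p)).

(** A tube argument: each point of the segment has a neighbourhood outside [K], and compactness of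
    [[0, 1]] makes the condition on [w] uniform. *)
Lemma near_avoids (K : set V) (T : topologicalType) (p q : T -> V) (u : T) :
  closed K -> p @ u --> p u -> q @ u --> q u -> avoids K (p u) (q u) ->
  \forall w \near u, avoids K (p w) (q w).
Proof.
move=> clK cp cq av.
have := @segment_compact R 0 1 => /compact_near_coveringP.
move=> /(_ T (nbhs u) (fun w t => ~ K (p w + t *: (q w - p w))) _) cov.
have hw : \forall w \near u, [set` `[0 : R, 1]] `<=` (fun t => ~ K (p w + t *: (q w - p w))).
  apply: cov => t.
  rewrite /= in_itv/= => t01.
  have [r r0 hr] : exists2 r : R, 0 < r & forall y, `|p u + t *: (q u - p u) - y| < r -> ~ K y.
    apply/nbhs_dist; apply: open_nbhs_nbhs; split; last exact: av.
    exact: closed_openC.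
  (* The three error terms below carry the factors 3, 2 and 1, so their sum is at most
     [6 * (r / 9) < r]. *)
  have r3 : 0 < r / 9 by rewrite divr_gt0.
  have [s s0 hs] := small_scale (q u - p u) r3.
  have near_dist (g : T -> V) e : g @ u --> g u -> 0 < e -> \forall w \near u, `|g u - g w| < e.
    by move=> cg e0; apply: (cg [set y | `|g u - y| < e]); apply/nbhs_dist; exists e.
  exists ([set t' | `|t - t'| < Num.min s 1],
          [set w | `|p u - p w| < r / 9 /\ `|q u - q w| < r / 9]).
    split => /=; last by apply: filterI; exact: near_dist.
    have s1 : 0 < Num.min s 1 by rewrite lt_min s0 ltr01.
    by apply/nbhs_normP; exists (Num.min s 1).
  move=> [t' w] /= [tt [hp hq]].
  apply: hr; move: tt; rewrite lt_min => /andP[ts t1].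
  have -> : p u + t *: (q u - p u) - (p w + t' *: (q w - p w)) =
    (1 - t') *: (p u - p w) + t' *: (q u - q w) + (t - t') *: (q u - p u).
    by apply/rowP => i; rewrite !mxE; ring.
  have h1 : `|(t - t') *: (q u - p u)| < r / 9 by apply: hs; exact: ltW.
  have t2 : `|t'| <= 2.
    move: t1; rewrite ltr_norml => /andP[t1 t1']; rewrite ler_norml; lra.
  have t3 : `|1 - t'| <= 3.
    move: t1; rewrite ltr_norml => /andP[t1 t1']; rewrite ler_norml; lra.
  have h2 : `|t' *: (q u - q w)| <= 2 * (r / 9) by rewrite normrZ ler_pM// ltW.
  have h3 : `|(1 - t') *: (p u - p w)| <= 3 * (r / 9) by rewrite normrZ ler_pM// ltW.
  rewrite (le_lt_trans (ler_normD _ _))//.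
  have := ler_normD ((1 - t') *: (p u - p w)) (t' *: (q u - q w)); lra.
by near=> w => t t01; apply: (near hw w) => //; rewrite /= in_itv.
Unshelve. all: by end_near. Qed.

End Segments.

(** * Primitives of integrable functions *)

HB.lock Definition prim {R : realType} (g : R -> R) (t : R) : R :=
  \int[@lebesgue_measure R]_(x in `]-oo, t]) g x.

Section Primitive.
Context {R : realType}.
Local Notation mu := (@lebesgue_measure R).
Implicit Types (g : R -> R) (s t p e : R).

Lemma measurable_itv_real (i : interval R) : measurable [set` i].
Proof. exact: measurable_itv. Qed.

Lemma integrable_sub g (A : set R) : mu.-integrable setT (EFin \o g) -> measurable A ->
  mu.-integrable A (EFin \o g).
Proof. by move=> ig mA; exact: (integrableS (E := setT)). Qed.

Lemma integrable_subI f (A B : set R) : measurable A -> measurable B ->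
  mu.-integrable B f -> mu.-integrable (A `&` B) f.
Proof. by move=> mA mB; apply: integrableS => //; exact: measurableI. Qed.

Lemma primB g s t : mu.-integrable setT (EFin \o g) -> s <= t ->
  prim g t - prim g s = \int[mu]_(x in `]s, t]) g x.
Proof.
move=> ig st; rewrite prim.unlock; apply: Rintegral_itvB => //.
exact: integrable_sub.
Qed.

Lemma primB_cc g s t : mu.-integrable setT (EFin \o g) -> s <= t ->
  prim g t - prim g s = \int[mu]_(x in `[s, t]) g x.
Proof.
move=> ig st; rewrite primB// Rintegral_itv_obnd_cbnd//.
exact: integrable_sub.
Qed.

Lemma primD f g t : mu.-integrable setT (EFin \o f) -> mu.-integrable setT (EFin \o g) ->
  prim (f \+ g) t = prim f t + prim g t.
Proof. by move=> fi gi; rewrite prim.unlock RintegralD//; exact: integrable_sub. Qed.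

Lemma prim_small g e : mu.-integrable setT (EFin \o g) -> 0 < e ->
  exists2 r : R, 0 < r & forall s t, `|s - t| < r -> `|prim g s - prim g t| < e.
Proof.
move=> ig e0; have [r [r0 hr]] := integral_normr_continuous ig e0.
exists r => //.
have H s t : s <= t -> `|s - t| < r -> `|prim g s - prim g t| < e.
  move=> st sr; rewrite distrC primB//.
  rewrite (le_lt_trans (le_normr_Rintegral _ _))//; first exact: integrable_sub.
  apply: hr; first exact: measurable_itv.
    rewrite [ltLHS]lebesgue_measure_itv/=; case: ifP => // _; rewrite ?lte_fin//.
  by rewrite (le_lt_trans _ sr)// distrC ler_norm.
move=> s t; have [st|ts] := leP s t; first exact: H.
by rewrite distrC => /(H _ _ (ltW ts)); rewrite distrC.
Qed.

Lemma prim_continuous g : mu.-integrable setT (EFin \o g) -> continuous (prim g).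
Proof.
move=> ig t; apply/(@cvgrPdist_lt R R^o R (nbhs t)) => e e0.
have [r r0 hr] := prim_small ig e0.
by apply/nbhs_normP; exists r => // s /hr.
Qed.

(** Differentiability of [prim g] at [p] with derivative [g p], stated for intervals around [p]
    because [p] will be an arbitrary point of a cell of a partition. *)
Definition straddle_pt g p := forall e, 0 < e ->
  exists2 r : R, 0 < r & forall s t, s <= p <= t -> t - s < r ->
    `|prim g t - prim g s - g p * (t - s)| <= e * (t - s).

(** Lebesgue differentiation controls the two pieces [[s, p]] and [[p, t]]; their errors are
    proportional to lengths that add up to [t - s]. *)
Lemma ae_straddle g : mu.-integrable setT (EFin \o g) ->
  mu.-negligible [set p | ~ straddle_pt g p].
Proof.
move=> ig.
have lg : locally_integrable setT g.
  have /integrableP[mg fin] := ig.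
  split; [exact/measurable_EFinP|exact: openT|].
  move=> K _ cK; apply: le_lt_trans fin.
  apply: ge0_subset_integral => //; first exact: compact_measurable.
  apply/measurable_EFinP; apply: measurableT_comp => //; exact/measurable_EFinP.
have := @FTC1Ny R g (fun y => integrable_sub ig (measurable_itv_real _)) lg.
have primE : prim g = fun y => \int[mu]_(x in `]-oo, y]) g x by rewrite prim.unlock.
apply: negligibleS => p np [+ +]; rewrite -primE => dg gp; apply: np => e e0.
have dF : h^-1 *: (prim g (h *: 1 + p) - prim g p) @[h --> 0^'] --> g p.
  by rewrite -gp derive1E; exact: dg.
have /cvgrPdist_le/(_ e e0) := dF; rewrite near_withinE => /nbhs_normP[r /= r0 hr].
exists r => // s t /andP[sp pt] st.
have H u : `|u| < r -> `|prim g (u + p) - prim g p - g p * u| <= e * `|u|.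
  move=> ur; have [->|u0] := eqVneq u 0.
    by rewrite add0r subrr mulr0 subr0 normr0 mulr0.
  have := hr u; rewrite /= sub0r normrN => /(_ ur u0).
  rewrite [u *: 1]mulr1 /GRing.scale/= => h.
  rewrite -ler_pdivrMr ?normr_gt0// -normf_div -normrN; apply: le_trans h.
  by rewrite le_eqVlt; apply/orP; left; apply/eqP; congr `|_|; field.
have -> : prim g t - prim g s - g p * (t - s) =
  (prim g t - prim g p - g p * (t - p)) - (prim g s - prim g p - g p * (s - p)) by ring.
rewrite (le_trans (ler_normB _ _))//.
have tp : `|t - p| = t - p by rewrite ger0_norm ?subr_ge0.
have ps : `|s - p| = - (s - p) by rewrite ler0_norm ?subr_le0.
have h1 : `|prim g t - prim g p - g p * (t - p)| <= e * (t - p).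
  by have := H (t - p); rewrite subrK tp; apply; lra.
have h2 : `|prim g s - prim g p - g p * (s - p)| <= e * - (s - p).
  by have := H (s - p); rewrite subrK ps; apply; lra.
lra.
Qed.

(** Cover [N] by an open set [O] of small measure and add [|g| - g + 1] to [g] on [O]. The sum is
    [|g| + 1] there, so its primitive increases strictly near each point of [N], while the added
    function is nonnegative with small integral. *)
Lemma perturb g N e : mu.-integrable setT (EFin \o g) -> mu.-negligible N -> 0 < e ->
  exists H : R -> R, [/\ continuous H,
    (forall s t, s <= t -> 0 <= (H t - prim g t) - (H s - prim g s) <= e) &
    (forall p, N p -> \forall w \near p, (w < p -> H w < H p) /\ (p < w -> H p < H w))].
Proof.
move=> ig [A [mA A0 NA]] e0.
have e4 : 0 < e / 4 by rewrite divr_gt0.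
have [r [r0 hr]] := integral_normr_continuous ig e4.
(* Measure below [r] makes the integral of [|g|] over [O] less than [e / 4], and measure below
   [e / 4] handles the constant 1; the total is at most three quarters of [e]. *)
have [||O [oO AO OA]] := @lebesgue_regularity_outer R A (Num.min (e / 4) r) mA.
- by rewrite [ltLHS]A0.
- by rewrite lt_min e4.
have mO : measurable O by exact: open_measurable.
have muO : (mu O < (Num.min (e / 4) r)%:E)%E.
  apply: le_lt_trans OA; have -> : O = A `|` (O `\` A) by rewrite setDUK.
  by rewrite (le_trans (measureU2 _ _ _))//= ?setDUK// ?[X in (X + _)%E]A0 ?add0e//; exact: measurableD.
move: muO; rewrite EFin_min lt_min => /andP[muO muOr].
have fO : (mu O < +oo)%E by rewrite (lt_trans muO)// ltry.
pose w0 x := `|g x| - g x + 1.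
pose w := w0 \_ O.
have ign : mu.-integrable setT (EFin \o (fun x => `|g x|)) by exact: integrable_norm.
have i1 : mu.-integrable O (EFin \o cst 1).
  by apply: measurable_bounded_integrable => //; exact: bounded_cst.
have iw0 : mu.-integrable O (EFin \o w0).
  rewrite (_ : EFin \o w0 = ((EFin \o (fun x => `|g x|%R)) \- (EFin \o g) \+ (EFin \o cst 1%R))%E)//.
  by apply: integrableD => //; apply: integrableB => //; exact: integrable_sub.
have iw : mu.-integrable setT (EFin \o w).
  by rewrite /w -restrict_EFin; apply/integrable_restrict => //=; rewrite setTI.
have w_ge0 x : 0 <= w x.
  by rewrite /w patchE; case: ifP => // _; rewrite /w0 addr_ge0// subr_ge0 ler_norm.
have igw : mu.-integrable setT (EFin \o (g \+ w)).
  by rewrite (_ : _ \o _ = ((EFin \o g) \+ (EFin \o w))%E)//; exact: integrableD.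
have Hd t : prim (g \+ w) t - prim g t = prim w t by rewrite primD// addrAC subrr add0r.
exists (prim (g \+ w)); split; first exact: prim_continuous.
  move=> s t st; rewrite !Hd primB// Rintegral_ge0//=.
  have -> : \int[mu]_(x in `]s, t]) w x = \int[mu]_(x in `]s, t] `&` O) w0 x.
    by rewrite [RHS]Rintegral_mkcondr.
  have iw0' : mu.-integrable (`]s, t] `&` O) (EFin \o w0).
    exact: integrable_subI.
  have mI : measurable (`]s, t] `&` O) by exact: measurableI.
  have igI : mu.-integrable (`]s, t] `&` O) (EFin \o (fun x => `|g x|)) by exact: integrable_sub.
  have i1I : mu.-integrable (`]s, t] `&` O) (EFin \o cst 1) by exact: integrable_subI.
  have I3 : mu.-integrable (`]s, t] `&` O) (EFin \o (fun x => `|g x| + `|g x|)).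
    rewrite (_ : _ \o _ = ((EFin \o (fun x => `|g x|%R)) \+ (EFin \o (fun x => `|g x|%R)))%E)//.
    exact: integrableD.
  have I2 : mu.-integrable (`]s, t] `&` O) (EFin \o (fun x => (`|g x| + `|g x|) + 1)).
    rewrite (_ : _ \o _ = ((EFin \o (fun x => (`|g x| + `|g x|)%R)) \+ (EFin \o cst 1%R))%E)//.
    exact: integrableD.
  apply: (@le_trans _ _ (\int[mu]_(x in `]s, t] `&` O) ((`|g x| + `|g x|) + 1))).
    apply: le_Rintegral => // x _; rewrite /w0 lerD2r lerD2l.
    by rewrite -normrN ler_norm.
  have muI : (mu (`]s, t] `&` O) <= mu O)%E by apply: le_measure; rewrite ?inE.
  rewrite !RintegralD// Rintegral_cst// mul1r.
  have := hr _ mI (le_lt_trans muI muOr).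
  have : fine (mu (`]s, t] `&` O)) <= e / 4.
    rewrite -lee_fin fineK; first exact: le_trans muI (ltW muO).
    by rewrite ge0_fin_numE// (le_lt_trans muI).
  lra.
move=> p /NA/AO Op.
have [q q0 hq] : exists2 q : R, 0 < q & forall x, `|p - x| < q -> O x.
  by apply/nbhs_normP; apply: open_nbhs_nbhs.
have inc s t : s < t -> (forall x, s < x <= t -> O x) -> prim (g \+ w) s < prim (g \+ w) t.
  move=> st sO; rewrite -subr_gt0 primB// ?ltW//.
  apply: (@lt_le_trans _ _ (\int[mu]_(x in `]s, t]) 1)).
    rewrite Rintegral_cst// mul1r [X in fine X]lebesgue_measure_itv/= lte_fin st/= subr_gt0//.
  apply: le_Rintegral => //.
  - apply: measurable_bounded_integrable => //; last exact: bounded_cst.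
    by rewrite [ltLHS]lebesgue_measure_itv/= lte_fin st ltry.
  - exact: integrable_sub.
  - move=> x /=; rewrite in_itv/= => /sO Ox.
    rewrite /w patchE mem_set// /w0; have := normr_ge0 (g x); lra.
apply/nbhs_normP; exists q => // v /=; rewrite ltr_norml => /andP[pv pv'].
by split => h; apply: inc => // x /andP[h1 h2]; apply: hq; rewrite ltr_norml; lra.
Qed.

Lemma not_negligible_itv N s t : s < t -> mu.-negligible N -> exists2 p, s < p < t & ~ N p.
Proof.
move=> st [A [mA A0 NA]]; apply: contrapT => h.
have : (mu `]s, t[ <= mu A)%E.
  apply: le_measure; rewrite ?inE//.
  move=> x /=; rewrite in_itv/= => sx; apply: NA; apply: contrapT => nx.
  by apply: h; exists x.
by rewrite [leRHS]A0 [leLHS]lebesgue_measure_itv/= lte_fin st leNgt lte_fin subr_gt0 st.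
Qed.

(* A minimiser of a perturbation [H] of [prim g] that is strictly increasing at every
   point of [N] lies outside [N]; since [H - prim g] is nondecreasing, it is also a
   running minimum of [prim g]. *)
Lemma left_minimum g N s t : mu.-integrable setT (EFin \o g) -> mu.-negligible N ->
  s < t -> (forall u, s <= u <= t -> prim g u <= prim g s) ->
  exists p, [/\ s < p <= t, ~ N p & forall u, s <= u <= p -> prim g p <= prim g u].
Proof.
move=> ig nN st hle.
have [[u0 su0 hu0]|nlt] := pselect (exists2 u, s <= u <= t & prim g u < prim g s); last first.
  have {}nlt u : s <= u <= t -> prim g u = prim g s.
    move=> su; apply/eqP; rewrite eq_le hle//= leNgt; apply/negP => lt; apply: nlt.
    by exists u.
  have [p /andP[sp pt] Np] := not_negligible_itv st nN.
  exists p; split => //; first by rewrite sp ltW.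
  move=> u /andP[su up]; rewrite !nlt// ?su ?(ltW sp) ?(ltW pt)//.
  by rewrite (le_trans up)// ltW.
(* Half the drop from [s] to [u0]: the perturbation cannot undo the drop, so the minimiser of [H] is
   not [s] and has points of the interval to its left. *)
have e0 : 0 < (prim g s - prim g u0) / 2 by rewrite divr_gt0// subr_gt0.
have [H [cH Hg HN]] := perturb ig nN e0.
have [p pst pmin] := EVT_min (ltW st) (continuous_subspaceT cH).
have {}pmin u : s <= u <= t -> H p <= H u by move=> su; apply: pmin; rewrite in_itv.
move: pst; rewrite in_itv/= => /andP[sp pt].
have ps : p != s.
  apply/eqP => ps; have := pmin _ su0; rewrite ps => H0.
  have /andP[su ut] := su0.
  have /andP[_ h1] := Hg s u0 su; lra.
have {}sp : s < p by rewrite lt_def ps.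
exists p; split; first by rewrite sp.
  move=> /HN/nbhs_normP[r r0 hr].
  pose w := Num.max s (p - r / 2).
  have wp : w < p by rewrite gt_max sp ltrBlDr ltrDl divr_gt0.
  have ws : s <= w by rewrite le_max lexx.
  have : `|p - w| < r.
    have : p - r / 2 <= w by rewrite le_max lexx orbT.
    rewrite gtr0_norm ?subr_gt0// => ?; have : 0 < r by []. lra.
  move=> /hr[/(_ wp) + _]; rewrite ltNge pmin// ws (le_trans (ltW wp))//.
move=> u /andP[su up].
have /pmin : s <= u <= t by rewrite su (le_trans up pt).
have /andP[+ _] := Hg u p up; lra.
Qed.


(** Mirror image of [left_minimum]: a maximiser of [H] other than [t] cannot lie in [N], because [H]
    would take larger values just to its right. *)
Lemma right_maximum g N s t : mu.-integrable setT (EFin \o g) -> mu.-negligible N ->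
  s < t -> (forall u, s <= u <= t -> prim g t <= prim g u) ->
  exists p, [/\ s <= p < t, ~ N p & forall u, p <= u <= t -> prim g u <= prim g p].
Proof.
move=> ig nN st hle.
have [[u0 su0 hu0]|nlt] := pselect (exists2 u, s <= u <= t & prim g t < prim g u); last first.
  have {}nlt u : s <= u <= t -> prim g u = prim g t.
    move=> su; apply/eqP; rewrite eq_le [X in _ && X]hle//= andbT leNgt; apply/negP => lt.
    by apply: nlt; exists u.
  have [p /andP[sp pt] Np] := not_negligible_itv st nN.
  exists p; split => //; first by rewrite ltW.
  move=> u /andP[su up]; rewrite !nlt// ?up ?(ltW sp) ?(ltW pt)//.
  by rewrite (le_trans _ su)// ltW.
have e0 : 0 < (prim g u0 - prim g t) / 2 by rewrite divr_gt0// subr_gt0.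
have [H [cH Hg HN]] := perturb ig nN e0.
have [p pst pmax] := EVT_max (ltW st) (continuous_subspaceT cH).
have {}pmax u : s <= u <= t -> H u <= H p by move=> su; apply: pmax; rewrite in_itv.
move: pst; rewrite in_itv/= => /andP[sp pt].
have pt' : p != t.
  apply/eqP => ps; have := pmax _ su0; rewrite ps => H0.
  have /andP[su ut] := su0.
  have /andP[_ h1] := Hg u0 t ut; lra.
have {}pt : p < t by rewrite lt_neqAle pt'.
exists p; split; first by rewrite sp.
  move=> /HN/nbhs_normP[r r0 hr].
  pose w := Num.min t (p + r / 2).
  have wp : p < w by rewrite lt_min pt ltrDl divr_gt0.
  have ws : w <= t by rewrite ge_min lexx.
  have : `|p - w| < r.
    have : w <= p + r / 2 by rewrite ge_min lexx orbT.
    rewrite ltr0_norm ?subr_lt0// => ?; have : 0 < r by []. lra.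
  by move=> /hr[_ /(_ wp)]; rewrite ltNge pmax// ws (le_trans sp)// ltW.
move=> u /andP[su up].
have /pmax : s <= u <= t by rewrite up (le_trans sp su).
have /andP[+ _] := Hg p u su; lra.
Qed.

End Primitive.

(** * Averages *)

(** Cut off outside [[0, 1]], where nothing is known about [psi], to be integrable on the whole
    line. *)
Definition coord01 {R : realType} {d : nat} (psi : R -> 'rV[R]_d) (i : 'I_d) : R -> R :=
  (fun x => psi x 0 i) \_ `[0, 1].

Definition Psi {R : realType} {d : nat} (psi : R -> 'rV[R]_d) (t : R) : 'rV[R]_d :=
  \row_i prim (coord01 psi i) t.

(** The average over [[s, t]] as a difference quotient of the primitive (see [avgE]), a form in
    which its continuity in both endpoints is visible. *)
HB.lock Definition slope {R : realType} {d : nat} (psi : R -> 'rV[R]_d) (s t : R) : 'rV[R]_d :=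
  (t - s)^-1 *: (Psi psi t - Psi psi s).

Section Path.
Context {R : realType} {d : nat}.
Local Notation V := 'rV[R]_d.
Local Notation mu := (@lebesgue_measure R).
Variable psi : R -> V.
Hypothesis ipsi : forall i, mu.-integrable `[0, 1] (fun x => (psi x 0 i)%:E).
Implicit Types (a : V) (s t p e c : R).

Lemma integrable_coord01 i : mu.-integrable setT (EFin \o coord01 psi i).
Proof.
by rewrite /coord01 -restrict_EFin; apply/integrable_restrict => //=; rewrite setTI; exact: ipsi.
Qed.
Hint Resolve integrable_coord01 : core.

Lemma coord01E i x : 0 <= x <= 1 -> coord01 psi i x = psi x 0 i.
Proof. by move=> x01; rewrite /coord01 patchE mem_set//= in_itv. Qed.

Lemma avgE s t : 0 <= s -> s < t -> t <= 1 -> avg psi s t = slope psi s t.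
Proof.
move=> s0 st t1; apply/rowP => i; rewrite slope.unlock !mxE (primB_cc (integrable_coord01 i) (ltW st)); congr (_ * _).
rewrite /Rintegral; congr fine; apply: eq_integral => x; rewrite inE/= in_itv/= => /andP[sx xt].
by rewrite coord01E// (le_trans s0)// (le_trans xt).
Qed.

Lemma near_row (T : topologicalType) (u : T) (g : T -> V) :
  (forall i, (fun w => g w 0 i) @ u --> g u 0 i) -> g @ u --> g u.
Proof.
move=> h; apply: continuous_dist => r r0.
have r2 : 0 < r / 2 by rewrite divr_gt0.
have : \forall w \near u, forall i, `|g u 0 i - g w 0 i| < r / 2.
  apply: filter_forall => i; have /cvgrPdist_lt := h i; exact.
apply: filterS => w hw; apply: (@le_lt_trans _ _ (r / 2)); last lra.
by apply: norm_le_coord; rewrite ?ltW// => i; rewrite !mxE ltW.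
Qed.

Lemma slope_continuous (T : topologicalType) (u : T) (f g : T -> R) :
  f @ u --> f u -> g @ u --> g u -> f u < g u ->
  (fun w => slope psi (f w) (g w)) @ u --> slope psi (f u) (g u).
Proof.
move=> cf cg fg; apply: (@near_row _ u (fun w => slope psi (f w) (g w))) => i; rewrite slope.unlock !mxE.
under eq_fun do rewrite !mxE.
apply: cvgM.
  by apply: cvgV; [rewrite gt_eqF// subr_gt0|exact: cvgB].
apply: cvgB.
  by apply: continuous_cvg cg; exact: prim_continuous.
by apply: continuous_cvg cf; exact: prim_continuous.
Qed.

Definition diff_pt p := forall i, straddle_pt (coord01 psi i) p.

Lemma ae_diff_pt : mu.-negligible [set p | ~ diff_pt p].
Proof.
pose F (n : nat) : set R := [set p | exists2 i : 'I_d, n = i & ~ straddle_pt (coord01 psi i) p].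
suff : mu.-negligible (\bigcup_n F n).
  by apply: negligibleS => p /existsNP[i Hi]; exists i => //=; exists i.
apply: negligible_bigcup => n; have [nd|nd] := ltnP n d.
  apply: negligibleS (ae_straddle (integrable_coord01 (Ordinal nd))) => p /= [i ni].
  by rewrite (_ : Ordinal nd = i)//; exact: val_inj.
rewrite (_ : F n = set0); first exact: negligible_set0.
by apply/seteqP; split => // p [i ni _]; move: nd; rewrite ni leqNgt ltn_ord.
Qed.

Lemma diff_pt_slope p e : 0 <= p <= 1 -> diff_pt p -> 0 < e ->
  exists2 r : R, 0 < r & forall s t, s <= p <= t -> s < t -> t - s < r ->
    `|slope psi s t - psi p| <= e.
Proof.
move=> p01 dp e0.
have /boolp.choice[r hr] : forall i, exists r : R, 0 < r /\ forall s t, s <= p <= t -> t - s < r ->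
    `|prim (coord01 psi i) t - prim (coord01 psi i) s - coord01 psi i p * (t - s)| <= e * (t - s).
  by move=> i; have [r r0 hr] := dp i e e0; exists r.
exists (\big[Num.min/1]_i r i).
  by rewrite lt_bigmin//= => i _; case: (hr i).
move=> s t spt st /bigmin_gtP[_ rts].
apply: norm_le_coord => [|i]; first exact: ltW.
have ts : 0 < t - s by rewrite subr_gt0.
have := (hr i).2 _ _ spt (rts i isT).
rewrite coord01E// -ler_pdivrMr// -[X in _ / X](gtr0_norm ts) -normf_div; apply: le_trans.
rewrite le_eqVlt; apply/orP; left; apply/eqP; congr `|_|.
by rewrite slope.unlock !mxE; field; rewrite gt_eqF.
Qed.

(** Its primitive is, up to a constant, the function H of the overview. *)
Definition offset a c : R -> R := (fun x => dotv a (psi x) - c) \_ `[0, 1].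

Lemma prim_lin n (f : 'I_n -> R -> R) (l : 'I_n -> R) :
  (forall i, mu.-integrable setT (EFin \o f i)) ->
  mu.-integrable setT (EFin \o (fun x => \sum_i l i * f i x)) /\
  forall t, prim (fun x => \sum_i l i * f i x) t = \sum_i l i * prim (f i) t.
Proof.
move=> fi; elim: (index_enum _) => [|i s [ih1 ih2]].
  have E : (fun x : R => \sum_(i <- [::]) l i * f i x) = cst 0.
    by apply/funext => x; rewrite big_nil.
  split; first by rewrite E; exact: integrable0.
  by move=> t; rewrite E big_nil prim.unlock Rintegral_cst// mul0r.
have ili : mu.-integrable setT (EFin \o (fun x => l i * f i x)).
  rewrite (_ : _ \o _ = (fun x => (l i)%:E * (EFin \o f i) x)%E); first exact: integrableZl.
  by apply/funext => x /=; rewrite EFinM.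
have E : (fun x : R => \sum_(i <- i :: s) l i * f i x) =
    (fun x => l i * f i x) \+ (fun x => \sum_(i <- s) l i * f i x).
  by apply/funext => x; rewrite big_cons.
split.
  by rewrite E (_ : _ \o _ = ((EFin \o (fun x => l i * f i x)%R) \+
    (EFin \o (fun x => \sum_(i <- s) l i * f i x)%R))%E)//; exact: integrableD.
move=> t; rewrite E primD// ih2 big_cons; congr (_ + _).
by rewrite prim.unlock RintegralZl//; exact: integrable_sub.
Qed.

Lemma offsetE a c : offset a c =
  (fun x => \sum_i a 0 i * coord01 psi i x) \+ ((fun=> - c) \_ `[0, 1]).
Proof.
apply/funext => x; rewrite /offset /= !patchE; case: ifPn => x01.
  by congr (_ - _); apply: eq_bigr => i _; rewrite /coord01 patchE x01.
by rewrite big1 ?add0r// => i _; rewrite /coord01 patchE (negPf x01) mulr0.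
Qed.

Lemma integrable_cst01 c : mu.-integrable setT (EFin \o ((fun=> - c) \_ `[0, 1])).
Proof.
rewrite -restrict_EFin; apply/integrable_restrict => //=; rewrite setTI.
apply: measurable_bounded_integrable => //; last exact: bounded_cst.
by rewrite [ltLHS]lebesgue_measure_itv/= lte_fin ltr01 ltry.
Qed.

Lemma integrable_offset a c : mu.-integrable setT (EFin \o offset a c).
Proof.
rewrite offsetE (_ : _ \o _ = ((EFin \o (fun x => \sum_i a 0 i * coord01 psi i x)%R) \+
    (EFin \o ((fun=> - c) \_ `[0, 1])%R))%E)//.
apply: integrableD => //; last exact: integrable_cst01.
exact: (prim_lin (fun i => a 0 i) integrable_coord01).1.
Qed.

Lemma prim_offset a c s t : 0 <= s -> s <= t -> t <= 1 ->
  prim (offset a c) t - prim (offset a c) s = dotv a (Psi psi t - Psi psi s) - c * (t - s).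
Proof.
move=> s0 st t1; have [i1 i2] := prim_lin (fun i => a 0 i) integrable_coord01.
rewrite offsetE !primD//; try exact: integrable_cst01.
rewrite opprD addrACA; congr (_ + _).
  rewrite !i2 -sumrB; apply: eq_bigr => i _.
  by rewrite !mxE mulrBr.
rewrite primB_cc//; last exact: integrable_cst01.
rewrite (@eq_Rintegral _ _ _ _ _ (fun=> - c)); last first.
  move=> x; rewrite inE/= in_itv/= => /andP[sx xt]; rewrite patchE mem_set//= in_itv/=.
  by rewrite (le_trans s0)// (le_trans xt).
rewrite Rintegral_cst// [X in fine X]lebesgue_measure_itv/= lte_fin.
move: st; rewrite le_eqVlt => /predU1P[->|->]; last by rewrite mulNr.
by rewrite ltxx subrr mulr0 mulr0 oppr0.
Qed.

(** The sign of the increment of H thus tells on which side of the hyperplane [{a = c}] the average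
    lies. *)
Lemma dotv_slope a c s t : 0 <= s -> s < t -> t <= 1 ->
  (dotv a (slope psi s t) - c) * (t - s) = prim (offset a c) t - prim (offset a c) s.
Proof.
move=> s0 st t1; rewrite (prim_offset _ _ s0 (ltW st) t1) slope.unlock dotvZr; field.
by rewrite gt_eqF// subr_gt0.
Qed.

(** A functional that strictly separated the average from [A] would have a nonpositive integral of
    [dotv b (psi x) - c], against [dotv_slope]. *)
Lemma slope_closed_convex (A : set V) s t : (0 < d)%N -> Defs.convex A -> closed A ->
  (forall x, 0 <= x <= 1 -> A (psi x)) -> 0 <= s -> s < t -> t <= 1 -> A (slope psi s t).
Proof.
move=> d0 cA clA Apsi s0 st t1; apply: contrapT => nA.
have [b [c bA cb]] := strict_separation d0 cA clA nA.
have : prim (offset b c) t - prim (offset b c) s <= 0.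
  rewrite (primB (integrable_offset _ _) (ltW st)).
  apply: (@le_trans _ _ (\int[mu]_(x in `]s, t]) 0)); last by rewrite Rintegral_cst// mul0r.
  apply: le_Rintegral => //; first exact: (integrable_sub (integrable_offset b c)).
    exact: integrable0.
  move=> x _; rewrite /offset patchE; case: ifPn => // /set_mem; rewrite /= in_itv/= => x01.
  by rewrite subr_le0 bA//; exact: Apsi.
rewrite -dotv_slope// leNgt pmulr_lgt0 ?subr_gt0// => /negP; exact.
Qed.

End Path.

(** * Measurability of compositions with [psi] *)

Section Measurability.
Context {R : realType} {d : nat}.
Local Notation V := 'rV[R]_d.
Local Notation mu := (@lebesgue_measure R).

(** Only the coordinates are known to be measurable, so [O] is written as the countable union of the
    rational cubes that it contains. *)
Lemma measurable_preimage_open (psi : R -> V) (D : set R) (O : set V) : measurable D ->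
  (forall i, measurable_fun D (fun x => psi x 0 i)) -> open O ->
  measurable (D `&` psi @^-1` O).
Proof.
move=> mD mpsi oO.
pose B (q : 'rV[rat]_d * nat) : set V := [set y | forall i, `|y 0 i - ratr (q.1 0 i)| < q.2.+1%:R^-1].
pose F (q : 'rV[rat]_d * nat) : set R := if pselect (B q `<=` O) then D `&` psi @^-1` (B q) else set0.
suff -> : D `&` psi @^-1` O = \bigcup_q F q.
  apply: countable_bigcupT_measurable => // q; rewrite /F; case: pselect => [_|_] //=.
  rewrite (_ : D `&` _ = \bigcap_(i in [set: 'I_d])
     (D `&` (fun x => psi x 0 i) @^-1` [set t | `|t - ratr (q.1 0 i)| < q.2.+1%:R^-1]) `&` D); last first.
    apply/seteqP; split => x /= [h1 h2]; first by split => // i _; split => //; exact: h2.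
    by split => // i; have [] := h1 i I.
  apply: measurableI => //; apply: fin_bigcap_measurable; first exact: finite_finset.
  move=> i _.
  apply: mpsi => //; rewrite (_ : mkset _ = ball (ratr (q.1 0 i) : R) q.2.+1%:R^-1).
    exact: measurable_ball.
  by apply/seteqP; split => t; rewrite -ball_normE /= distrC.
apply/seteqP; split => x; last first.
  move=> [q _]; rewrite /F; case: pselect => //= BO [Dx Bx]; split => //; exact: BO.
move=> [Dx Ox].
have [r r0 rO] : exists2 r : R, 0 < r & forall y, `|psi x - y| < r -> O y.
  by apply/nbhs_dist; exact: open_nbhs_nbhs.
have [n nr] : exists n : nat, n.+1%:R^-1 < r / 2.
  have r2 : 0 < r / 2 by rewrite divr_gt0.
  exists (Num.truncn (r / 2)^-1).
  rewrite -[ltRHS]invrK ltf_pV2 ?posrE ?invr_gt0//.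
  by rewrite truncnS_gt.
have /boolp.choice[q hq] i : exists q : rat, `|psi x 0 i - ratr q| < n.+1%:R^-1.
  have n0 : 0 < n.+1%:R^-1 :> R by rewrite invr_gt0.
  have [|q] := @rat_in_itvoo R (psi x 0 i - n.+1%:R^-1) (psi x 0 i + n.+1%:R^-1).
    by rewrite ltrD2l gtrN.
  rewrite in_itv/= => /andP[h1 h2]; exists q.
  move: (n.+1%:R^-1) h1 h2 => e h1 h2; rewrite ltr_norml; lra.
exists (\row_i q i, n) => //; rewrite /F; case: pselect => [BO|[]] /=.
  by split => // i /=; rewrite mxE.
move: nr => /[dup] nr; set e := n.+1%:R^-1 => er y By.
apply: rO; apply: (@le_lt_trans _ _ (e + e)); last by lra.
apply: norm_le_coord => [|i]; first by rewrite addr_ge0// invr_ge0.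
have := By i; rewrite /= !mxE => yi.
rewrite -(subrKA (ratr (q i))) (le_trans (ler_normD _ _))// lerD//.
  exact/ltW/hq.
by rewrite distrC ltW.
Qed.

(** Since [f] is continuous only on [F], the preimage of an interval is the trace on [F] of an open
    set, and [psi] does not leave [F]. *)
Lemma measurable_comp_within (psi : R -> V) (f : V -> R) (D : set R) (F : set V) :
  measurable D -> (forall i, measurable_fun D (fun x => psi x 0 i)) ->
  (forall x, D x -> F (psi x)) -> {within F, continuous f} ->
  measurable_fun D (f \o psi).
Proof.
move=> mD mpsi DF /continuousP cf _; apply: (measurability _ (RGenOpens.measurableE R)) => //.
move=> _ [_ [a [b ->] <-]].
have /cf/open_subspaceP[U oU UF] : open [set` `]a, b[] by exact: interval_open.
rewrite (_ : _ `&` _ = D `&` psi @^-1` U); first exact: measurable_preimage_open.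
apply/seteqP; split => x /= [Dx h]; split => //.
  have UFx : ((f @^-1` [set` `]a, b[]) `&` F) (psi x) by split => //; exact: DF.
  by rewrite -UF in UFx; case: UFx.
have UFx : (U `&` F) (psi x) by split => //; exact: DF.
by rewrite UF in UFx; case: UFx.
Qed.

End Measurability.

(** * Splitting intervals *)

Lemma mean_between {R : realType} (p q x y : R) : p < x -> p < y -> x < q -> y < q ->
  p <= (x + y) / 2 <= q.
Proof. by move=> *; apply/andP; split; lra. Qed.

Lemma line_comb {R : realType} {d : nat} (p q : 'rV[R]_d) (t : R) :
  p + t *: (q - p) = t *: q + (1 - t) *: p.
Proof. by apply/rowP => i; rewrite !mxE; ring. Qed.

Section SegmentGeometry.
Context {R : realType} {d : nat}.
Local Notation V := 'rV[R]_d.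
Variables (K : set V) (p q : V) (l : R).
Hypothesis cK : Defs.convex K.
Hypothesis l01 : 0 < l < 1.
Let x := p + l *: (q - p).

Lemma avoids_glue : avoids K x p -> avoids K x q -> avoids K p q.
Proof.
have /andP[l0 l1] := l01 => Pu Qu t /andP[t0 t1].
have [tl|lt] := leP t l.
  have -> : p + t *: (q - p) = x + (1 - t / l) *: (p - x).
    by rewrite /x; apply/rowP => i; rewrite !mxE; field; rewrite gt_eqF.
  by apply: Pu; rewrite subr_ge0 ler_pdivrMr// mul1r tl /= gerBl divr_ge0// ltW.
have -> : p + t *: (q - p) = x + ((t - l) / (1 - l)) *: (q - x).
  by rewrite /x; apply/rowP => i; rewrite !mxE; field; rewrite gt_eqF//; lra.
apply: Qu; rewrite ler_pdivrMr ?subr_gt0// mul1r lerD2r t1 andbT divr_ge0// ?subr_ge0; exact: ltW.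
Qed.

(** Points of [K] on both sides of [x] on one line would put [x] into [K]. *)
Lemma avoids_one_side : ~ K x -> ~ avoids K x p -> ~ avoids K x q -> False.
Proof.
have /andP[l0 l1] := l01 => nK.
move=> /existsNP[q1 /not_implyP[/andP[q10 q11] /contrapT K1]].
move=> /existsNP[q2 /not_implyP[/andP[q20 q21] /contrapT K2]].
apply: nK; rewrite -[x]addr0 -(scale0r (q - p)).
apply: (@convex_line _ _ K x (q - p) (- (q1 * l)) 0 (q2 * (1 - l))) => //.
- rewrite oppr_le0 !mulr_ge0//; lra.
- move: K1; congr (K _); rewrite /x; apply/rowP => i; rewrite !mxE; ring.
- move: K2; congr (K _); rewrite /x; apply/rowP => i; rewrite !mxE; ring.
Qed.

End SegmentGeometry.

Section Splitting.
Context {R : realType} {d : nat}.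
Local Notation V := 'rV[R]_d.
Local Notation mu := (@lebesgue_measure R).
Variables (OmI : set V) (psi : R -> V).
Local Notation K := (convhull OmI).
Local Notation X := (slope psi).
Hypothesis clI : closed OmI.
Hypothesis clK : closed K.
Hypothesis intK : interior K !=set0.
Hypothesis compK : forall C, components (interior K `\` OmI) C ->
  exists (a : V) (c : R), supporting_hyperplane K a c /\ bdry C `\` OmI `<=` hyperplane a c.
Hypothesis ipsi : forall i, mu.-integrable `[0, 1] (fun x => (psi x 0 i)%:E).
Hypothesis slopeI : forall s t, 0 <= s -> s < t -> t <= 1 -> ~ OmI (X s t).
Hypothesis psiK : forall x, 0 <= x <= 1 -> ~ K (psi x).
Implicit Types (s t u e : R) (C : set V) (a : V) (c : R).

Lemma closure_component_hull C : components (interior K `\` OmI) C -> closure C `<=` K.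
Proof.
by move=> hC x /(component_closure_sub hC); rewrite -(closure_id K).1.
Qed.

Lemma slope_continuousr s t : s < t -> {for t, continuous (X s)}.
Proof.
move=> st; apply: (@slope_continuous _ _ _ ipsi _ t (fun=> s) id) => //.
exact: cvg_cst.
Qed.

Lemma slope_continuousl s t : s < t -> {for s, continuous (fun s => X s t)}.
Proof.
move=> st; apply: (@slope_continuous _ _ _ ipsi _ s id (fun=> t)) => //.
exact: cvg_cst.
Qed.

Section Face.
Variables (C : set V) (a : V) (c : R).
Hypothesis hC : components (interior K `\` OmI) C.
Hypothesis sup : supporting_hyperplane K a c.
Hypothesis aC : bdry C `\` OmI `<=` hyperplane a c.
Local Notation H := (prim (offset psi a c)).

Lemma dotv_slope_le s t : 0 <= s -> s < t -> t <= 1 -> H t <= H s -> dotv a (X s t) <= c.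
Proof.
move=> s0 st t1 Hts; rewrite -subr_le0 -(pmulr_lle0 _ (x := t - s)) ?subr_gt0//.
by rewrite dotv_slope// subr_le0.
Qed.

Lemma dotv_slope_gt s t : 0 <= s -> s < t -> t <= 1 -> H s < H t -> c < dotv a (X s t).
Proof.
move=> s0 st t1 Hts; rewrite -subr_gt0 -(pmulr_lgt0 _ (x := t - s)) ?subr_gt0//.
by rewrite dotv_slope// subr_gt0.
Qed.

(* Otherwise the averages over [(s, w)], [w] decreasing to a running minimum [p] of [H],
   and then over [(w, p)], [w] increasing to [p], never leave [closure C]; their limit
   is [psi p], which is not in [K]. *)
Lemma exists_above s t : 0 <= s -> s < t -> t <= 1 -> H s = H t -> closure C (X s t) ->
  exists2 u, s < u < t & H s < H u.
Proof.
move=> s0 st t1 Hst Cst; apply: contrapT => hle.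
have {}hle u : s <= u <= t -> H u <= H s.
  move=> /andP[]; rewrite le_eqVlt => /predU1P[->//|su].
  rewrite le_eqVlt => /predU1P[->|ut]; first by rewrite Hst.
  by rewrite leNgt; apply/negP => h; apply: hle; exists u => //; rewrite su.
have [p [/andP[sp pt] /contrapT dp pmin]] :=
  left_minimum (integrable_offset ipsi a c) (ae_diff_pt ipsi) st hle.
have p1 : p <= 1 by rewrite (le_trans pt).
have Csp : closure C (X s p).
  have lo : p <= p <= t by rewrite lexx pt.
  have hi : p <= t <= t by rewrite lexx pt.
  apply: (path_in_component clI hC sup aC (g := (X s)) (s := p) (t := t) _ _ (u := t) (w := p) hi lo Cst).
    by move=> u /andP[pu ut]; apply: slope_continuousr; rewrite (lt_le_trans sp).
  move=> u /andP[pu ut]; have su := lt_le_trans sp pu; have u1 := le_trans ut t1.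
  by split; [apply: dotv_slope_le => //; apply: hle; rewrite ltW|exact: slopeI].
have Cqp q : s <= q < p -> closure C (X q p).
  move=> /andP[sq qp].
  have lo : s <= s <= q by rewrite lexx sq.
  have hi : s <= q <= q by rewrite lexx sq.
  apply: (path_in_component clI hC sup aC (g := (fun w => X w p)) (s := s) (t := q) _ _ (u := s) (w := q) lo hi Csp).
    by move=> u /andP[su uq]; apply: slope_continuousl; rewrite (le_lt_trans uq).
  move=> u /andP[su uq]; have up := le_lt_trans uq qp; have u0 := le_trans s0 su.
  by split; [apply: dotv_slope_le => //; apply: pmin; rewrite su ltW|exact: slopeI].
have p01 : 0 <= p <= 1 by rewrite p1 (le_trans s0)// ltW.
apply: (psiK p01); rewrite (closure_id K).1//; apply/closure_dist => r r0.
have r2 : 0 < r / 2 by rewrite divr_gt0.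
have [e e0 he] := diff_pt_slope p01 dp r2.
pose q := Num.max s (p - e / 2).
have qp : q < p by rewrite gt_max sp ltrBlDr ltrDl divr_gt0.
exists (X q p); first by apply: closure_component_hull hC _ _; apply: Cqp; rewrite qp le_max lexx.
rewrite distrC (le_lt_trans (he q p _ _ _))//; first by rewrite lexx ltW.
  have : p - e / 2 <= q by rewrite le_max lexx orbT.
  lra.
lra.
Qed.

(** Mirror image of [exists_above]: the left endpoint moves up to a point [p] where [H] is maximal
    on [[p, t]], and then the right endpoint moves down to [p]. *)
Lemma exists_below s t : 0 <= s -> s < t -> t <= 1 -> H s = H t -> closure C (X s t) ->
  exists2 u, s < u < t & H u < H s.
Proof.
move=> s0 st t1 Hst Cst; apply: contrapT => hle.
have {}hle u : s <= u <= t -> H t <= H u.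
  rewrite -Hst => /andP[]; rewrite le_eqVlt => /predU1P[->//|su].
  rewrite le_eqVlt => /predU1P[->|ut]; first by rewrite Hst.
  by rewrite leNgt; apply/negP => h; apply: hle; exists u => //; rewrite su.
have [p [/andP[sp pt] /contrapT dp pmax]] :=
  right_maximum (integrable_offset ipsi a c) (ae_diff_pt ipsi) st hle.
have p0 : 0 <= p by rewrite (le_trans s0).
have Cpt : closure C (X p t).
  have lo : s <= s <= p by rewrite lexx sp.
  have hi : s <= p <= p by rewrite lexx sp.
  apply: (path_in_component clI hC sup aC (g := (fun w => X w t)) (s := s) (t := p) _ _ (u := s) (w := p) lo hi Cst).
    by move=> u /andP[su up]; apply: slope_continuousl; rewrite (le_lt_trans up).
  move=> u /andP[su up]; have ut := le_lt_trans up pt; have u0 := le_trans s0 su.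
  by split; [apply: dotv_slope_le => //; apply: hle; rewrite su ltW|exact: slopeI].
have Cpq q : p < q <= t -> closure C (X p q).
  move=> /andP[pq qt].
  have lo : q <= q <= t by rewrite lexx qt.
  have hi : q <= t <= t by rewrite lexx qt.
  apply: (path_in_component clI hC sup aC (g := (X p)) (s := q) (t := t) _ _ (u := t) (w := q) hi lo Cpt).
    by move=> u /andP[qu ut]; apply: slope_continuousr; rewrite (lt_le_trans pq).
  move=> u /andP[qu ut]; have pu := lt_le_trans pq qu; have u1 := le_trans ut t1.
  by split; [apply: dotv_slope_le => //; apply: pmax; rewrite ut ltW|exact: slopeI].
have p01 : 0 <= p <= 1 by rewrite p0 (le_trans _ t1)// ltW.
apply: (psiK p01); rewrite (closure_id K).1//; apply/closure_dist => r r0.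
have r2 : 0 < r / 2 by rewrite divr_gt0.
have [e e0 he] := diff_pt_slope p01 dp r2.
pose q := Num.min t (p + e / 2).
have pq : p < q by rewrite lt_min pt ltrDl divr_gt0.
exists (X p q); first by apply: closure_component_hull hC _ _; apply: Cpq; rewrite pq ge_min lexx.
rewrite distrC (le_lt_trans (he p q _ _ _))//; first by rewrite lexx ltW.
  have : q <= p + e / 2 by rewrite ge_min lexx orbT.
  lra.
lra.
Qed.

Definition splits (k s t : R) :=
  exists2 u, s + k <= u <= t - k & avoids K (X s u) (X u t).

(** Here [H s < H t], and a point [u] between [u0] and [u1] where [H] equals their mean has
    increments of [H] positive on both sides. Both averages then lie in the half-space [{a > c}],
    which misses [K]. *)
Lemma face_split k s t u0 u1 : 0 < k -> 0 <= s -> s < t -> t <= 1 -> c < dotv a (X s t) ->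
  H u1 < H s < H u0 -> H u1 < H t < H u0 ->
  s + k <= Num.min u0 u1 -> Num.max u0 u1 <= t - k -> splits k s t.
Proof.
move=> k0 s0 st t1 ast /andP[H11 H12] /andP[H21 H22] ks kt.
have Hst : H s < H t by rewrite -subr_gt0 -dotv_slope// mulr_gt0// subr_gt0.
have cH : continuous H by apply: prim_continuous; exact: integrable_offset.
have uu : Num.min u0 u1 <= Num.max u0 u1 by rewrite ge_min le_max lexx.
have [u /andP[lu ul] Hu] : exists2 u, Num.min u0 u1 <= u <= Num.max u0 u1 & H u = (H s + H t) / 2.
  have [|u] := @IVT _ H _ _ ((H s + H t) / 2) uu (continuous_subspaceT cH).
    have [u01|u10] := leP u0 u1.
      have /andP[h3 h4] := mean_between H11 H21 H12 H22.
      by rewrite ge_min le_max h3 h4 orbT.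
    have /andP[h3 h4] := mean_between H11 H21 H12 H22.
    by rewrite ge_min le_max h3 h4 orbT.
  by rewrite in_itv/= => uab Hu; exists u.
have su : s + k <= u by rewrite (le_trans ks).
have ut : u <= t - k by rewrite (le_trans ul).
exists u; first by rewrite su.
have {}su : s < u by rewrite (lt_le_trans _ su)// ltrDl.
have {}ut : u < t by rewrite (le_lt_trans ut)// ltrBlDr ltrDl.
have [Hm1 Hm2] := midf_lt Hst; rewrite -Hu in Hm1 Hm2.
have A1 : c < dotv a (X s u).
  by apply: dotv_slope_gt => //; rewrite (le_trans _ t1)// ltW.
have A2 : c < dotv a (X u t).
  by apply: dotv_slope_gt => //; rewrite (le_trans s0)// ltW.
have [_ aK _] := sup.
move=> q q01 /aK; rewrite leNgt => /negP; apply.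
rewrite line_comb.
rewrite -ltrN2 -dotvNl.
have B1 : dotv (- a) (X s u) < - c by rewrite dotvNl ltrN2; exact: A1.
have B2 : dotv (- a) (X u t) < - c by rewrite dotvNl ltrN2; exact: A2.
exact: (convex_dotv_lt B2 B1 q01).
Qed.

End Face.

Lemma slope_split s u t : s < u -> u < t ->
  X s t = X s u + ((t - u) / (t - s)) *: (X u t - X s u).
Proof.
move=> su ut; rewrite slope.unlock; apply/rowP => i; rewrite !mxE; field.
by rewrite !gt_eqF//; lra.
Qed.

(* For [X s t] outside [K], the segment from it to [X s u] misses [K] for [u] near [t], the
   one to [X u t] misses [K] for [u] near [s], and by convexity they never both meet [K];
   as avoiding [K] is an open condition on [u], some [u] works for both. *)
Lemma exists_split s t : s < t -> ~ K (X s t) ->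
  exists2 u, s < u < t & avoids K (X s u) (X u t).
Proof.
move=> st nK; apply: contrapT => nsplit.
pose x := X s t.
pose P u := ~ avoids K x (X s u); pose Q u := ~ avoids K x (X u t).
have ratio u : s < u -> u < t -> 0 < (t - u) / (t - s) < 1.
  move=> su ut; have ts : 0 < t - s by lra.
  by rewrite divr_gt0 ?subr_gt0//= ltr_pdivrMr// mul1r ltrD2l ltrN2.
have PQ u : s < u < t -> P u \/ Q u.
  move=> /andP[su ut]; apply: contrapT => /not_orP[/contrapT + /contrapT].
  rewrite /x (slope_split su ut) => Pu Qu.
  by apply: nsplit; exists u; [rewrite su|exact: avoids_glue (ratio u su ut) Pu Qu].
have nPQ u : s < u < t -> P u -> Q u -> False.
  move=> /andP[su ut]; rewrite /P /Q /x; move: nK; rewrite (slope_split su ut).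
  exact: (avoids_one_side (convex_convhull (A := OmI)) (ratio u su ut)).
have nearP u : s < u -> ~ P u -> \forall w \near u, ~ P w.
  move=> su /contrapT av.
  have nav : \forall w \near u, avoids K x (X s w).
    exact: (@near_avoids _ _ K _ (fun=> x) (X s) u clK (cvg_cst _) (slope_continuousr su) av).
  by apply: filterS nav => w aw /(_ aw).
have nearQ u : u < t -> ~ Q u -> \forall w \near u, ~ Q w.
  move=> ut /contrapT av.
  have nav : \forall w \near u, avoids K x (X w t).
    exact: (@near_avoids _ _ K _ (fun=> x) (fun w => X w t) u clK (cvg_cst _) (slope_continuousl ut) av).
  by apply: filterS nav => w aw /(_ aw).
have avx : avoids K x x by move=> q _; rewrite subrr scaler0 addr0.
have nPt : ~ P t by apply.
have nQs : ~ Q s by apply.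
clearbody P Q.
have [m sm mt] : exists2 m, s < m & m < t by exists ((s + t) / 2); lra.
have [b /andP[mb bt] nPb] : exists2 b, m < b < t & ~ P b.
  have /nbhs_normP[r /= r0 hr] := nearP t st nPt.
  pose b := Num.max ((m + t) / 2) (t - r / 2).
  have bt : b < t by rewrite gt_max; apply/andP; split; lra.
  have mb : (m + t) / 2 <= b by rewrite le_max lexx.
  have rb : t - r / 2 <= b by rewrite le_max lexx orbT.
  exists b; first by rewrite bt andbT; lra.
  by apply: hr; rewrite /= gtr0_norm ?subr_gt0//; move: r0 => /= r0; lra.
have [a /andP[sa am] nQa] : exists2 a, s < a < m & ~ Q a.
  have /nbhs_normP[r /= r0 hr] := nearQ s st nQs.
  pose a := Num.min ((s + m) / 2) (s + r / 2).
  have sa : s < a by rewrite lt_min; move: r0 => /= r0; apply/andP; split; lra.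
  have ma : a <= (s + m) / 2 by rewrite ge_min lexx.
  have ra : a <= s + r / 2 by rewrite ge_min lexx orbT.
  exists a; first by rewrite sa /=; lra.
  by apply: hr; rewrite /= ltr0_norm ?subr_lt0//; move: r0 => /= r0; lra.
have ab : a < b by rewrite (lt_trans am).
have inab w : a <= w <= b -> s < w < t.
  by move=> /andP[aw wb]; rewrite (lt_le_trans sa)// (le_lt_trans wb).
(* In the absence of a split [P] is the negation of [Q], by [PQ] and [nPQ]. The openness of [~ Q]
   thus makes [P] open, so that [P] propagates from [a] to [b]. *)
have hP u : a <= u <= b -> P u -> \forall w \near u, a <= w <= b -> P w.
  move=> /inab sut Pu; have nQu : ~ Q u by move=> Qu; exact: nPQ sut Pu Qu.
  have /andP[_ ut] := sut.
  by apply: filterS (nearQ u ut nQu) => w nQw /inab /PQ[].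
have hN u : a <= u <= b -> ~ P u -> \forall w \near u, a <= w <= b -> ~ P w.
  move=> /inab/andP[su _] nPu.
  by apply: filterS (nearP u su nPu) => w nPw _.
have Pa : P a by have [|//|/nQa] := PQ a; rewrite ?sa ?(lt_trans ab).
have aa : a <= a <= b by rewrite lexx ltW.
have bb : a <= b <= b by rewrite lexx ltW.
exact: nPb (interval_clopen hP hN aa bb Pa).
Qed.

(* The delicate case is [X s t] on the boundary of [K]: near it [K] is a half-space
   [{a <= c}], and a splitting point with both averages in [{a > c}] is found by the
   intermediate value theorem between the points of [exists_above] and [exists_below]. *)
Lemma local_split s t : 0 <= s -> s < t -> t <= 1 -> exists2 k, 0 < k &
  \forall w \near (s, t), 0 <= w.1 -> w.1 < w.2 -> w.2 <= 1 -> ~ K (X w.1 w.2) -> splits k w.1 w.2.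
Proof.
move=> s0 st t1.
have cX : (fun w : R * R => X w.1 w.2) @ (s, t) --> X s t.
  apply: (@slope_continuous _ _ _ ipsi _ (s, t) fst snd) => //; [exact: cvg_fst|exact: cvg_snd].
have near1 (A : set R) : nbhs s A -> \forall w \near (s, t), A w.1.
  by move=> nA; apply: (@cvg_fst _ _ (nbhs s) (nbhs t)).
have near2 (A : set R) : nbhs t A -> \forall w \near (s, t), A w.2.
  by move=> nA; apply: (@cvg_snd _ _ (nbhs s) (nbhs t)).
have near_s k : 0 < k -> \forall w \near (s, t), w.1 < s + k.
  move=> k0; apply: (near1 [set v | v < s + k]); apply: lt_nbhsl; by rewrite ltrDl.
have near_t k : 0 < k -> \forall w \near (s, t), t - k < w.2.
  move=> k0; apply: (near2 [set v | t - k < v]); apply: lt_nbhsr; by rewrite ltrBlDr ltrDl.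
have [Kst|nKst] := pselect (K (X s t)); last first.
  have [u /andP[su ut] av] := exists_split st nKst.
  pose k := Num.min (u - s) (t - u) / 2.
  have k0 : 0 < k by rewrite divr_gt0// lt_min !subr_gt0 su.
  have ks : k <= (u - s) / 2 by rewrite ler_pM2r ?invr_gt0// ge_min lexx.
  have kt : k <= (t - u) / 2 by rewrite ler_pM2r ?invr_gt0// ge_min lexx orbT.
  have cp : (fun w : R * R => X w.1 u) @ (s, t) --> X s u.
    apply: (@slope_continuous _ _ _ ipsi _ (s, t) fst (fun=> u)) => //; exact: cvg_cst.
  have cq : (fun w : R * R => X u w.2) @ (s, t) --> X u t.
    apply: (@slope_continuous _ _ _ ipsi _ (s, t) (fun=> u) snd) => //; exact: cvg_cst.
  have nav : \forall w \near (s, t), avoids K (X w.1 u) (X u w.2).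
    exact: (@near_avoids _ _ K _ _ _ (s, t) clK cp cq av).
  exists k => //; near=> w => _ _ _ _; exists u.
    have : w.1 < s + k by near: w; exact: near_s.
    have : t - k < w.2 by near: w; exact: near_t.
    by move=> h1 h2; apply/andP; split; lra.
  by near: w; exact: nav.
have [iK|niK] := pselect (interior K (X s t)).
  exists 1 => //; have : \forall w \near (s, t), K (X w.1 w.2) by apply: cX; exact: iK.
  by apply: filterS => w Kw _ _ _ /(_ Kw).
have [C [a [c [hC sup aC Cst ast]]]] :=
  boundary_hyperplane clI intK compK (subset_closure Kst) niK (slopeI s0 st t1).
pose H := prim (offset psi a c).
have cH : continuous H by apply: prim_continuous; exact: integrable_offset.
have Hst : H s = H t.
  by apply/eqP; rewrite eq_sym -subr_eq0 -dotv_slope// ast subrr mul0r.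
have [u0 /andP[su0 u0t] Hu0] := exists_above hC sup aC s0 st t1 Hst Cst.
have [u1 /andP[su1 u1t] Hu1] := exists_below hC sup aC s0 st t1 Hst Cst.
have [r r0 hr] := component_local clI hC sup aC Cst (slopeI s0 st t1).
pose a0 := Num.min u0 u1; pose b0 := Num.max u0 u1.
have sa0 : s < a0 by rewrite lt_min su0.
have b0t : b0 < t by rewrite gt_max u0t.
have ab0 : a0 <= b0 by rewrite ge_min le_max lexx.
(* Half of the smaller gap: the other half is left for the displacement of the endpoints,
   [w.1 < s + k] and [t - k < w.2]. *)
pose k := Num.min (a0 - s) (t - b0) / 2.
have k0 : 0 < k by rewrite divr_gt0// lt_min !subr_gt0 sa0.
have ks : k <= (a0 - s) / 2 by rewrite ler_pM2r ?invr_gt0// ge_min lexx.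
have kt : k <= (t - b0) / 2 by rewrite ler_pM2r ?invr_gt0// ge_min lexx orbT.
have near_X : \forall w \near (s, t), `|X s t - X w.1 w.2| < r.
  by apply: (cX [set y | `|X s t - y| < r]); apply/nbhs_dist; exists r.
have near_H v : H v = H s -> \forall z \near v, H u1 < H z < H u0.
  move=> Hv; near=> z; apply/andP; split; near: z.
    by apply: (@cvgr_gt R R (nbhs v) _ H _ (cH v)); rewrite Hv.
  by apply: (@cvgr_lt R R (nbhs v) _ H _ (cH v)); rewrite Hv.
exists k => //.
have near_H1 := near1 _ (near_H s erefl).
have near_H2 := near2 _ (near_H t (esym Hst)).
have NN : \forall w \near (s, t), [/\ `|X s t - X w.1 w.2| < r, H u1 < H w.1 < H u0,
    H u1 < H w.2 < H u0, w.1 < s + k & t - k < w.2].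
  near=> w; split; near: w; [exact: near_X|exact: near_H1|exact: near_H2|
    exact: near_s|exact: near_t].
apply: filterS NN => w [Xw H1 H2 h1 h2] w10 w12 w21 nKw.
have aw : c < dotv a (X w.1 w.2).
  rewrite ltNge; apply/negP => aw; apply: nKw; apply: (closure_component_hull hC).
  exact: hr.
apply: (face_split sup k0 w10 w12 w21 aw H1 H2).
  by rewrite -/a0; clear -h1 ks; lra.
by rewrite -/b0; clear -h2 kt; lra.
Unshelve. all: by end_near. Qed.

End Splitting.

(** * Fine partitions by iterated splitting *)

Section Partition.
Context {R : realType}.
Local Notation mu := (@lebesgue_measure R).
Variables (D : R -> R -> Prop) (g : R -> R -> R).
Implicit Types (s t u e k : R).

(** [D s t] will say that the average over [[s, t]] is outside K, and [g s t] will be a truncation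
    of G at that average; the inequality is concavity multiplied by [t - s]. *)
Definition good_split s u t :=
  [/\ D s u, D u t & (u - s) * g s u + (t - u) * g u t <= (t - s) * g s t].

Hypothesis split_near : forall s t, 0 <= s -> s < t -> t <= 1 -> exists2 k, 0 < k &
  \forall w \near (s, t), 0 <= w.1 -> w.1 < w.2 -> w.2 <= 1 -> D w.1 w.2 ->
    exists2 u, w.1 + k <= u <= w.2 - k & good_split w.1 u w.2.

Lemma uniform_split e : 0 < e -> exists2 k, 0 < k &
  forall s t, 0 <= s -> s + e <= t -> t <= 1 -> D s t ->
    exists2 u, s + k <= u <= t - k & good_split s u t.
Proof.
move=> e0.
pose P k (w : R * R) := 0 <= w.1 -> w.1 + e <= w.2 -> w.2 <= 1 -> D w.1 w.2 ->
    exists2 u, w.1 + k <= u <= w.2 - k & good_split w.1 u w.2.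
have c01 := @segment_compact R 0 1.
have /compact_near_coveringP cov := compact_setX c01 c01.
have : \forall k \near 0^'+, ([set` `[0, 1]] `*` [set` `[0, 1]]) `<=` P k.
  apply: cov => -[s t] [/=]; rewrite !in_itv/= => /andP[s0 s1] /andP[t0 t1].
  have [st|ts] := ltP (s + e / 2) t.
    have [|k k0 hk] := split_near s0 _ t1; first lra.
    exists ([set w | 0 <= w.1 -> w.1 < w.2 -> w.2 <= 1 -> D w.1 w.2 ->
      exists2 u, w.1 + k <= u <= w.2 - k & good_split w.1 u w.2], [set k' | k' <= k]).
      by split => //=; exact: nbhs_right_le.
    move=> [w k'] [/= hw kk'] w0 we w1 Dw.
    have [|u /andP[u1 u2] gu] := hw w0 _ w1 Dw; first lra.
    by exists u => //; apply/andP; split; lra.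
  (* Here [t <= s + e / 2], so nearby pairs are still at distance less than [e] and the condition on
     them is vacuous. *)
  exists ([set w | w.1 + e > w.2], setT) => /=.
    split; last exact: filterT.
    have h1 : \forall w \near (s, t), s - e / 4 < w.1.
      apply: (@cvg_fst _ _ (nbhs s) (nbhs t) _ [set v | s - e / 4 < v]); apply: lt_nbhsr; lra.
    have h2 : \forall w \near (s, t), w.2 < t + e / 4.
      apply: (@cvg_snd _ _ (nbhs s) (nbhs t) _ [set v | v < t + e / 4]); apply: lt_nbhsl; lra.
    by near=> w => /=; have : s - e / 4 < w.1; [near: w|have : w.2 < t + e / 4; [near: w|lra]].
  by move=> [w k'] [/= hw _] _ we; exfalso; lra.
rewrite near_withinE => /nbhs_normP[r /= r0 hr].
exists (r / 2); first by rewrite divr_gt0.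
move=> s t s0 st t1 Dst.
apply: (hr (r / 2) _ _ (s, t)) => //=.
- by rewrite sub0r normrN gtr0_norm; lra.
- by rewrite divr_gt0.
- by split; rewrite /= in_itv/=; apply/andP; split; lra.
Unshelve. all: by end_near. Qed.

Variables (m M : R).
Hypothesis g_bound : forall s t, 0 <= s -> s < t -> t <= 1 -> D s t -> m <= g s t <= M.

(** A step function on a partition of mesh below [e], of which only the cell responsible for each
    point is remembered. *)
Definition sampled e s t (G : R -> R) := forall x, s <= x <= t ->
  exists s', exists2 t', [/\ s <= s' <= x, x <= t' <= t, s' < t' & t' - s' < e] &
    D s' t' /\ G x = g s' t'.

Definition fine_step e s t (G : R -> R) :=
  [/\ measurable_fun `[s, t] G, \int[mu]_(x in `[s, t]) G x <= (t - s) * g s t &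
   sampled e s t G].

Lemma sampled_integrable e s t G : 0 <= s -> t <= 1 -> measurable_fun `[s, t] G ->
  sampled e s t G -> mu.-integrable `[s, t] (EFin \o G).
Proof.
move=> s0 t1 mG GE; apply: measurable_bounded_integrable => //.
  rewrite [ltLHS]lebesgue_measure_itv/=; case: ifP => // _; by rewrite -EFinB ltry.
exists (`|m| + `|M|); split; first exact: num_real.
move=> N hN x /=; rewrite in_itv/= => /GE[s' [t' [/andP[ss' s'x] /andP[xt' t't] st' _] [Dst ->]]].
have /andP[h1 h2] := g_bound (le_trans s0 ss') st' (le_trans t't t1) Dst.
rewrite (le_trans _ (ltW hN))//.
have := ler_norm M; have := lerNnormlW (lexx `|m|); have := normr_ge0 m; have := normr_ge0 M.
rewrite ler_norml => *; apply/andP; split; lra.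
Qed.

Lemma fine_step_glue e s u t G1 G2 : 0 <= s -> s < u -> u < t -> t <= 1 -> good_split s u t ->
  fine_step e s u G1 -> fine_step e u t G2 ->
  fine_step e s t (fun x => if x <= u then G1 x else G2 x).
Proof.
move=> s0 su ut t1 [Dsu Dut gsut] F1 F2.
have [mG1 I1 E1] := F1; have [mG2 I2 E2] := F2.
have i2 := sampled_integrable (le_trans s0 (ltW su)) t1 mG2 E2.
set G := fun x => _.
have itvU : `[s, t]%classic = `[s, u] `|` `]u, t].
  by rewrite (@itv_bndbnd_setU _ _ _ (BRight u)) // bnd_simp ltW.
have G1E : {in `[s, u]%classic, G1 =1 G}.
  by move=> x; rewrite inE/= in_itv/= /G => /andP[_ ->].
have G2E : {in `]u, t]%classic, G2 =1 G}.
  by move=> x; rewrite inE/= in_itv/= /G => /andP[ux _]; rewrite leNgt ux.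
have sub2 : `]u, t]%classic `<=` `[u, t]%classic.
  by apply: subset_itvr; rewrite bnd_simp.
have mG : measurable_fun `[s, t] G.
  rewrite itvU; apply/measurable_funU => //; split.
    exact: eq_measurable_fun G1E mG1.
  by apply: eq_measurable_fun G2E _; exact: measurable_funS mG2.
have E : sampled e s t G.
  move=> x /andP[sx xt]; rewrite /G; have [xu|ux] := leP x u.
    have [|s' [t' [h1 /andP[h2 h2'] h3 h4] h5]] := E1 x; first by rewrite sx.
    by exists s', t' => //; split => //; rewrite h2 (le_trans h2')// ltW.
  have [|s' [t' [/andP[h1 h1'] h2 h3 h4] h5]] := E2 x; first by rewrite xt ltW.
  by exists s', t' => //; split => //; rewrite h1' (le_trans _ h1)// ltW.
split => //.
have mGi : mu.-integrable (`[s, u] `|` `]u, t]) (EFin \o G).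
  by rewrite -itvU; exact: sampled_integrable mG E.
rewrite itvU Rintegral_setU//; last first.
  apply/disj_setPS => x [/=]; rewrite !in_itv/= => /andP[_ xu] /andP[ux _].
  by move: (le_lt_trans xu ux); rewrite ltxx.
have -> : \int[mu]_(x in `[s, u]) G x = \int[mu]_(x in `[s, u]) G1 x.
  by apply: eq_Rintegral => x xs; rewrite G1E.
have -> : \int[mu]_(x in `]u, t]) G x = \int[mu]_(x in `]u, t]) G2 x.
  by apply: eq_Rintegral => x xs; rewrite G2E.
rewrite Rintegral_itv_obnd_cbnd; last exact: integrableS i2.
exact: le_trans (lerD I1 I2) gsut.
Qed.

Lemma exists_fine_step e s t : 0 < e -> 0 <= s -> s < t -> t <= 1 -> D s t ->
  exists G, fine_step e s t G.
Proof.
move=> e0 s0 st t1 Dst.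
have e2 : 0 < e / 2 by rewrite divr_gt0.
have [k k0 hk] := uniform_split e2.
(* The induction measure: both pieces of a split are shorter than the whole by at least [k], and an
   interval of length at most [e / 2] is a cell. *)
have [n hn] : exists n : nat, t - s <= e / 2 + n%:R * k.
  exists (Num.truncn (1 / k)).+1.
  have : 1 / k < (Num.truncn (1 / k)).+1%:R by rewrite truncnS_gt.
  rewrite ltr_pdivrMr// => /ltW h; rewrite (le_trans _ (lerD (ltW e2) h))//; lra.
elim: n s t s0 st t1 Dst hn => [|n ih] s t s0 st t1 Dst hn.
  exists (cst (g s t)); split; first exact: measurable_cst.
    by rewrite Rintegral_cst// [X in fine X]lebesgue_measure_itv/= lte_fin st/= mulrC.
  move=> x sxt; exists s, t => //; split; rewrite ?lexx//.
  - by have /andP[-> _] := sxt.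
  - by have /andP[_ ->] := sxt.
  - by rewrite mul0r addr0 in hn; rewrite (le_lt_trans hn)//; lra.
have [ts|ts] := leP (t - s) (e / 2).
  by apply: (ih) => //; rewrite (le_trans ts)// lerDl mulr_ge0// ltW.
have [|u /andP[su ut] gu] := hk s t s0 _ t1 Dst; first lra.
have [Dsu Dut _] := gu.
have nS : n.+1%:R * k = n%:R * k + k by rewrite -addn1 natrD mulrDl mul1r.
rewrite nS in hn.
have su' : s < u by lra.
have ut' : u < t by lra.
have [||G1 F1] := ih s u s0 su' _ Dsu; [lra|lra|].
have [||G2 F2] := ih u t _ ut' t1 Dut; [lra|lra|].
by exists (fun x => if x <= u then G1 x else G2 x); exact: fine_step_glue gu F1 F2.
Qed.

End Partition.

(** * Locally concave functions *)

Section LocallyConcave.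
Context {R : realType} {d : nat}.
Local Notation V := 'rV[R]_d.
Variables (OmO K : set V) (f : V -> R) (G : V -> \bar R).
Hypothesis d1 : (1 < d)%N.
Hypothesis scO : strictly_convex_open OmO.
Hypothesis cK : Defs.convex K.
Hypothesis clK : closed K.
Hypothesis KO : K `<=` OmO.
Hypothesis intK : interior K !=set0.
Hypothesis noray : ~ (exists S, is_ray S /\ S `<=` bdry K).
Hypothesis dirs : ray_dirs OmO = ray_dirs K.
Hypothesis lcG : locally_concave (closure OmO `\` K) G.
Hypothesis Gf : forall y, bdry OmO y -> G y = (f y)%:E.
Implicit Types (x y z v p q b : V) (s t u c r : R).

Let oO : open OmO. Proof. by have [] := scO. Qed.
Let cO : Defs.convex OmO. Proof. by have [] := scO. Qed.

Lemma concave_segment p q s u t : closure OmO p -> closure OmO q -> avoids K p q ->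
  0 <= t <= 1 -> (s%:E <= G p)%E -> (u%:E <= G q)%E ->
  ((t * s + (1 - t) * u)%:E <= G (t *: p + (1 - t) *: q))%E.
Proof.
move=> Op Oq av t01 sG uG.
pose C : set V := [set p + l *: (q - p) | l in [set l : R | 0 <= l <= 1]].
have Cp : C p by exists 0; rewrite /= ?lexx ?ler01// scale0r addr0.
have Cq : C q by exists 1; rewrite /= ?lexx ?ler01// scale1r subrKC.
have cC : Defs.convex C.
  move=> _ _ l [l1 /= /andP[l10 l11] <-] [l2 /= /andP[l20 l21] <-] /andP[l0 l1'].
  exists (l * l1 + (1 - l) * l2); first by apply/andP; split; nra.
  by apply/rowP => i; rewrite !mxE; ring.
have CD : C `<=` closure OmO `\` K.
  move=> _ [l /= l01 <-]; split; last exact: av.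
  by rewrite line_comb; apply: convex_closure.
exact: (lcG cC CD).
Qed.

(** [x] lies between the two points where its line leaves [OmO]; there [G] equals [f], which is at
    least [c], and concavity along the chord does the rest. *)
Lemma chord_lower x v T1 T2 c : OmO x -> 0 <= T1 -> ~ OmO (x + T1 *: v) ->
  0 <= T2 -> ~ OmO (x - T2 *: v) ->
  (forall t, - T2 <= t <= T1 -> ~ K (x + t *: v)) ->
  (forall t, - T2 <= t <= T1 -> bdry OmO (x + t *: v) -> c <= f (x + t *: v)) ->
  (c%:E <= G x)%E.
Proof.
move=> Ox T10 OT1 T20 OT2 nK cf.
have [t1 [/andP[t10 t1T] b1 _]] := boundary_crossing oO Ox T10 OT1.
have [|t2 [/andP[t20 t2T] b2 _]] := @boundary_crossing _ _ OmO x (- v) T2 oO Ox T20.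
  by rewrite scalerN.
rewrite scalerN -scaleNr in b2.
have pos t : 0 <= t -> ~ OmO (x + t *: v) -> 0 < t.
  by rewrite le_eqVlt => /predU1P[<-|//]; rewrite scale0r addr0.
have [cl1 n1] := (bdry_open _ oO).1 b1; have [cl2 n2] := (bdry_open _ oO).1 b2.
have t1p := pos _ t10 n1.
have tt : 0 < t1 + t2 by lra.
have t01 : 0 <= t2 / (t1 + t2) <= 1.
  by rewrite ler_pdivrMr// divr_ge0/= ?mul1r; lra.
have -> : x = (t2 / (t1 + t2)) *: (x + t1 *: v) + (1 - t2 / (t1 + t2)) *: (x + - t2 *: v).
  by apply/rowP => i; rewrite !mxE; field; rewrite gt_eqF.
have -> : c = t2 / (t1 + t2) * c + (1 - t2 / (t1 + t2)) * c by ring.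
apply: concave_segment => //; first last.
- by rewrite Gf// lee_fin; apply: cf => //; apply/andP; split; lra.
- by rewrite Gf// lee_fin; apply: cf => //; apply/andP; split; lra.
move=> l /andP[l0 l1].
have -> : x + t1 *: v + l *: (x + - t2 *: v - (x + t1 *: v)) = x + (t1 - l * (t1 + t2)) *: v.
  by apply/rowP => i; rewrite !mxE; ring.
by apply: nK; apply/andP; split; nra.
Qed.

(** The point [y + t *: v] is the limit, as [l] tends to 0, of combinations of [y] with the far
    point [x + (t / l) *: v] of the ray. *)
Lemma ray_translate x y v : K y -> (forall t, 0 <= t -> K (x + t *: v)) ->
  forall t, 0 <= t -> K (y + t *: v).
Proof.
move=> Ky Kx t t0; rewrite (closure_id K).1//; apply/closure_dist => r r0.
have [s s0 hs] := small_scale (x - y) r0.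
pose l := Num.min s 1.
have l0 : 0 < l by rewrite lt_min s0 ltr01.
have l1 : l <= 1 by rewrite ge_min lexx orbT.
exists (l *: (x + (t / l) *: v) + (1 - l) *: y).
  by apply: cK => //; [apply: Kx; rewrite divr_ge0// ltW|rewrite l1 ltW].
have -> : y + t *: v - (l *: (x + (t / l) *: v) + (1 - l) *: y) = (- l) *: (x - y).
  by apply/rowP => i; rewrite !mxE; field; rewrite gt_eqF.
by apply: hs; rewrite normrN gtr0_norm// ge_min lexx.
Qed.

(** A ray of [OmO] in the direction [v] would give one of [K], by equality of the cones, hence one
    issuing from [y]. That ray lies in the supporting hyperplane at [y], so in [bdry K]. *)
Lemma nonray_dir b y v : b != 0 -> (forall k, K k -> dotv b k <= dotv b y) -> K y ->
  dotv b v = 0 -> v != 0 -> forall x, OmO x -> exists2 T, 0 <= T & ~ OmO (x + T *: v).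
Proof.
move=> b0 bK Ky bv v0 x Ox; apply: contrapT => h.
have : ray_dirs OmO v.
  split => //; exists x => t t0; apply: contrapT => Ot; apply: h; by exists t.
rewrite dirs => -[_ [x1 Kx1]].
apply: noray; exists [set y + t *: v | t in [set t : R | 0 <= t]]; split.
  by exists y, v.
move=> _ [t /= t0 <-]; split; first exact/subset_closure/(ray_translate Ky Kx1).
move=> /(interior_dotv_lt b0 bK); rewrite dotvDr dotvZr bv mulr0 addr0.
by rewrite ltxx.
Qed.

(** Where the segment from an interior point of [K] to [x] leaves [interior K], take a supporting
    hyperplane; [x] is strictly beyond it. A line through [x] parallel to it misses [K] and, by
    [nonray_dir], leaves [OmO] at both ends. *)
Lemma locally_concave_ge (m : R) : (forall y, bdry OmO y -> m <= f y) ->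
  forall x, closure OmO x -> ~ K x -> (m%:E <= G x)%E.
Proof.
move=> mf x Ox nKx; have [Ox'|nOx] := pselect (OmO x); last first.
  have bx : bdry OmO x by apply/bdry_open.
  by rewrite Gf// lee_fin mf.
have [p Kp] := intK.
have [|t [/andP[t0 t1] bt _]] := @boundary_crossing _ _ (interior K) p (x - p) 1
  (@open_interior _ _) Kp ler01.
  by rewrite scale1r subrKC => /interior_subset.
set y := p + t *: (x - p) in bt.
have [clt nt] := (bdry_open _ (@open_interior _ K)).1 bt.
have Ky : K y.
  by rewrite (closure_id K).1//; move: clt; apply: closureS; exact: interior_subset.
have {}t1 : t < 1.
  rewrite lt_neqAle t1 andbT; apply/eqP => te; apply: nKx.
  by move: Ky; rewrite /y te scale1r subrKC.
have [b b0 bi] := separation (ltnW d1) (convex_interior cK) nt.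
have bK k : K k -> dotv b k <= dotv b y.
  move=> /subset_closure /(closure_interior cK Kp); exact: closure_dotv_le.
have py := interior_dotv_lt b0 bK Kp.
have yx : dotv b y < dotv b x.
  move: py; rewrite /y dotvDr dotvZr dotvBr; nra.
have [v v0 bv] := orthogonal_vector b d1.
have [T1 T10 OT1] := nonray_dir b0 bK Ky bv v0 Ox'.
have [||T2 T20 OT2] := @nonray_dir b y (- v) b0 bK Ky _ _ x Ox'.
- by rewrite dotvNr bv oppr0.
- by rewrite oppr_eq0.
apply: (@chord_lower x v T1 T2) => //.
- by rewrite -scalerN.
- by move=> l _ /bK; rewrite dotvDr dotvZr bv mulr0 addr0 leNgt yx.
- by move=> l _ /mf.
Qed.

(** Take [v] inside a supporting hyperplane of [OmO] at [z]. By strict convexity [z + h *: v] and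
    [z - h *: v] are outside [closure OmO], so for [x] near [z] the chord in the direction [v] ends
    near [z], where [f] is at least [f z - e]. *)
Lemma locally_concave_lsc z (e : R) : {within bdry OmO, continuous f} -> bdry OmO z -> 0 < e ->
  exists2 r, 0 < r & forall x, closure OmO x -> `|z - x| < r -> ((f z - e)%:E <= G x)%E.
Proof.
move=> cf bz e0; have [clz nOz] := (bdry_open _ oO).1 bz.
have [r1 r10 fr1] : exists2 r, 0 < r & forall y, `|z - y| < r -> bdry OmO y -> f z - e <= f y.
  have fz : f @ within (bdry OmO) (nbhs z) --> f z.
    by move/subspace_continuousP : cf; apply.
  have : \forall y \near within (bdry OmO) (nbhs z), f z - e <= f y.
    by apply: (@cvgr_ge R V _ _ f (f z) fz); rewrite ltrBlDr ltrDl.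
  by rewrite near_withinE => /nbhs_dist.
have [r2 r20 Kr2] : exists2 r, 0 < r & forall y, `|z - y| < r -> ~ K y.
  apply/nbhs_dist; apply: open_nbhs_nbhs; split; first exact: closed_openC.
  by move=> /KO.
pose r := Num.min r1 r2.
have r0 : 0 < r by rewrite lt_min r10.
have [b b0 bO] := separation (ltnW d1) cO nOz.
have [v v0 bv] := orthogonal_vector b d1.
have [|h h0 hv] := @small_scale _ _ v (r / 2); first by rewrite divr_gt0.
(* Otherwise the midpoint of [z] and [z + l *: v] would be an interior point of [OmO] on the
   supporting hyperplane. *)
have out l : l != 0 -> exists2 r', 0 < r' & forall w, `|z + l *: v - w| < r' -> ~ OmO w.
  move=> l0; have nz : ~ closure OmO (z + l *: v).
    move=> clO; have [_ _ _ sc] := scO.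
    have half : 0 < (1 / 2 : R) < 1 by apply/andP; split; lra.
    have := sc z (z + l *: v) (1 / 2) clz clO _ half.
    have -> : (z != z + l *: v).
      by rewrite -subr_eq0 opprD addNKr oppr_eq0 scaler_eq0 negb_or l0.
    move=> /(_ isT) Om.
    have Oi : interior OmO (1 / 2 *: z + (1 - 1 / 2) *: (z + l *: v)) by rewrite (interior_id _).1.
    have := interior_dotv_lt b0 bO Oi; rewrite !dotE bv; lra.
  have [r' r'0 hr'] : exists2 r', 0 < r' & forall w, `|z + l *: v - w| < r' -> ~ closure OmO w.
    apply/nbhs_dist; apply: open_nbhs_nbhs; split => //.
    by apply: closed_openC; exact: closed_closure.
  by exists r' => // w /hr' nw /subset_closure.
have [r3 r30 hr3] := out h (lt0r_neq0 h0).
have [r4 r40 hr4] : exists2 r', 0 < r' & forall w, `|z + - h *: v - w| < r' -> ~ OmO w.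
  by apply: out; rewrite oppr_eq0 gt_eqF.
exists (Num.min (r / 2) (Num.min r3 r4)); first by rewrite !lt_min divr_gt0// r30.
move=> x clx; rewrite !lt_min => /and3P[zr zr3 zr4].
have near_z l : `|l| <= h -> `|z - (x + l *: v)| < r.
  move=> lh; rewrite opprD addrA (le_lt_trans (ler_normB _ _))//.
  have := hv l lh; lra.
have [Ox|nOx] := pselect (OmO x); last first.
  have bx : bdry OmO x by apply/bdry_open.
  rewrite Gf// lee_fin; apply: fr1 => //.
  by rewrite (lt_le_trans zr)// (@le_trans _ _ r) ?ge_min ?lexx//; lra.
have shift l : z + l *: v - (x + l *: v) = z - x by rewrite opprD addrACA subrr addr0.
apply: (@chord_lower x v h h) => //; try exact: ltW.
- by apply: hr3; rewrite shift.
- by apply: hr4; rewrite -scaleNr shift.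
- move=> l; rewrite -ler_norml => /near_z; rewrite lt_min => /andP[_]; exact: Kr2.
- move=> l; rewrite -ler_norml => /near_z; rewrite lt_min => /andP[h1 _]; exact: fr1.
Qed.

End LocallyConcave.

(** * Passage to the limit *)

Lemma avoids_ends {R : realType} {d : nat} (K : set 'rV[R]_d) p q : avoids K p q -> ~ K p /\ ~ K q.
Proof.
move=> av; split.
  by have := av 0; rewrite scale0r addr0; apply; rewrite lexx ler01.
by have := av 1; rewrite scale1r subrKC; apply; rewrite lexx ler01.
Qed.

Section Barycenter.
Context {R : realType}.
Implicit Types s u t : R.

Lemma barycenter01 s u t : s < u -> u < t -> 0 <= (u - s) / (t - s) <= 1.
Proof.
move=> su ut; have ts : 0 < t - s by lra.
by apply/andP; split; [apply: divr_ge0; lra|rewrite ler_pdivrMr//; lra].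
Qed.

Lemma barycenter_le s u t a b c : s < u -> u < t ->
  (u - s) / (t - s) * a + (1 - (u - s) / (t - s)) * b <= c ->
  (u - s) * a + (t - u) * b <= (t - s) * c.
Proof.
move=> su ut; have ts : 0 < t - s by lra.
rewrite -(ler_pM2l ts); apply: le_trans.
rewrite le_eqVlt; apply/orP; left; apply/eqP; field; by rewrite gt_eqF.
Qed.

Lemma slope_barycenter {d : nat} (psi : R -> 'rV[R]_d) s u t : s < u -> u < t -> slope psi s t =
  ((u - s) / (t - s)) *: slope psi s u + (1 - (u - s) / (t - s)) *: slope psi u t.
Proof.
move=> su ut; rewrite (slope_split psi su ut).
move: (slope psi s u) (slope psi u t) => p q; apply/rowP => i; rewrite !mxE; field.
by rewrite gt_eqF//; lra.
Qed.

End Barycenter.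

Section Limit.
Context {R : realType}.
Local Notation mu := (@lebesgue_measure R).

Lemma limn_einf_le (u : (\bar R)^nat) (B : \bar R) : (forall n, (u n <= B)%E) -> (limn_einf u <= B)%E.
Proof.
move=> uB; rewrite limn_einf_lim; apply: lime_le; first exact: is_cvg_einfs.
apply: nearW => n; apply: le_trans (uB n).
by apply: ge_ereal_inf; exists (u n) => //; exists n => /=.
Qed.

(** The [g n] need not converge, but [min (h, g n)] tends to [h] off [N]; Fatou's lemma is applied
    to these minima. *)
Lemma fatou_bound (D N : set R) (h : R -> R) (g : nat -> R -> R) (B : \bar R) :
  measurable D -> mu.-negligible N ->
  measurable_fun D h -> (forall n, measurable_fun D (g n)) ->
  (forall x, D x -> 0 <= h x) -> (forall n x, D x -> 0 <= g n x) ->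
  (forall x e, D x -> ~ N x -> 0 < e -> exists n0, forall n, (n0 <= n)%N -> h x - e <= g n x) ->
  (forall n, (\int[mu]_(x in D) (g n x)%:E <= B)%E) ->
  (\int[mu]_(x in D) (h x)%:E <= B)%E.
Proof.
move=> mD [A [mA A0 NA]] mh mg h0 g0 hg gB.
have mDA : measurable (D `\` A) by exact: measurableD.
rewrite (ge0_negligible_integral mA mD _ _ A0); last 2 first.
- exact/measurable_EFinP.
- by move=> x Dx; rewrite lee_fin h0.
pose l n x : \bar R := (Num.min (h x) (g n x))%:E.
have ml n : measurable_fun (D `\` A) (l n).
  apply/measurable_EFinP; apply: measurable_minr.
    by apply: measurable_funS mh => //; exact: subDsetl.
  by apply: measurable_funS (mg n) => //; exact: subDsetl.
have l0 n x : (D `\` A) x -> (0 <= l n x)%E.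
  by move=> [Dx _]; rewrite lee_fin le_min h0//= g0.
have -> : (\int[mu]_(x in D `\` A) (h x)%:E = \int[mu]_(x in D `\` A) limn_einf (l^~ x))%E.
  apply: eq_integral => x /set_mem[Dx Ax].
  suff : l n x @[n --> \oo] --> (h x)%:E by move=> /cvg_limn_einf_sup[].
  apply: cvg_EFin; first exact: nearW.
  apply/(@cvgrPdist_le R R^o) => e e0.
  have [|n0 hn0] := hg x e Dx _ e0; first by move=> /NA.
  exists n0 => // n /= /hn0 hn; rewrite ger0_norm ?subr_ge0 ?ge_min ?lexx//.
  by rewrite lerBlDr -lerBlDl le_min hn andbT lerBlDr lerDl ltW.
apply: le_trans (fatou mu mDA ml l0) _; apply: limn_einf_le => n.
apply: le_trans (gB n).
apply: (@le_trans _ _ (\int[mu]_(x in D `\` A) (g n x)%:E)%E).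
  have mgn : measurable_fun (D `\` A) (fun x => (g n x)%:E).
    by apply/measurable_EFinP; apply: measurable_funS (mg n) => //; exact: subDsetl.
  apply: ge0_le_integral => //; [exact: l0|exact: ml|].
  by move=> x _; rewrite lee_fin ge_min lexx orbT.
apply: ge0_subset_integral => //; first by apply/measurable_EFinP; exact: mg.
by move=> x Dx; rewrite lee_fin g0.
Qed.

End Limit.

(** * The integral inequality in dimension at least two *)

Section Main.
Context {R : realType} {d : nat}.
Local Notation V := 'rV[R]_d.
Local Notation mu := (@lebesgue_measure R).
Variables (OmO OmI : set V) (f : V -> R) (psi : R -> V).
Hypothesis scO : strictly_convex_open OmO.
Hypothesis clI : closed OmI.
Hypothesis std : standing_assumptions OmO OmI.
Hypothesis cf : {within bdry OmO, continuous f}.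
Hypothesis psiA : A_Omega OmO OmI psi.
Local Notation K := (convhull OmI).
Local Notation X := (slope psi).

Lemma slope_notin s t : 0 <= s -> s < t -> t <= 1 -> ~ OmI (X s t).
Proof.
by move=> s0 st t1; have [ipsi _ av] := psiA; rewrite -avgE//; exact: av.
Qed.

Lemma slope_closure s t : (0 < d)%N -> 0 <= s -> s < t -> t <= 1 -> closure OmO (X s t).
Proof.
move=> d0 s0 st t1; have [ipsi bpsi _] := psiA; have [_ oO cO _] := scO.
apply: slope_closed_convex => //.
- exact: convex_closure.
- exact: closed_closure.
- by move=> x /bpsi[].
Qed.

Lemma hull_sub : K `<=` OmO.
Proof. by have [_ KO _ _ _] := std; move=> x /subset_closure /KO. Qed.

Lemma psi_notin x : 0 <= x <= 1 -> ~ K (psi x).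
Proof.
have [_ bpsi _] := psiA; have [_ oO cO _] := scO.
by move=> /bpsi /(bdry_open _ oO)[_ nO] /hull_sub.
Qed.

Lemma measurable_fpsi : measurable_fun ([set` `[0, 1]] : set R) (f \o psi).
Proof.
have [ipsi bpsi _] := psiA.
apply: (@measurable_comp_within _ _ psi f _ (bdry OmO)) => //.
by move=> i; have /integrableP[/measurable_EFinP] := ipsi i.
Qed.

Section Majorant.
Hypothesis d1 : (1 < d)%N.
Variables (m : R) (G : V -> \bar R).
Hypothesis mf : forall y, bdry OmO y -> m <= f y.
Hypothesis lcG : locally_concave (Omega_conv OmO OmI) G.
Hypothesis Gf : forall y, bdry OmO y -> G y = (f y)%:E.

Let clK : closed K.
Proof. by have [noray _ [intK _] _ compK] := std; exact: closed_hull. Qed.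

(* [G] may take the value [+oo]. *)
Let trunc n y : R := fine (Order.min (G y) (m + n%:R)%:E).

Let G_ge y : closure OmO y -> ~ K y -> (m%:E <= G y)%E.
Proof.
have [noray _ [intK dirs] _ compK] := std.
exact: (locally_concave_ge d1 scO (convex_convhull (A := OmI)) clK intK noray dirs lcG Gf mf).
Qed.

Let truncK n y : closure OmO y -> ~ K y -> (trunc n y)%:E = Order.min (G y) (m + n%:R)%:E.
Proof.
move=> Oy Ky; rewrite fineK// fin_numElt; apply/andP; split.
  by rewrite lt_min ltNyr andbT (lt_le_trans (ltNyr m))// G_ge.
by rewrite gt_min ltry orbT.
Qed.

Let trunc_bound n y : closure OmO y -> ~ K y -> m <= trunc n y <= m + n%:R.
Proof.
move=> Oy Ky; rewrite -!lee_fin truncK// le_min G_ge//= ge_min lexx orbT andbT.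
by rewrite lee_fin lerDl.
Qed.

Let trunc_concave n p q y l : closure OmO p -> closure OmO q -> avoids K p q -> 0 <= l <= 1 ->
  y = l *: p + (1 - l) *: q ->
  l * trunc n p + (1 - l) * trunc n q <= trunc n y.
Proof.
move=> Op Oq av l01 ->; have [_ _ cO _] := scO.
have [Kp Kq] := avoids_ends av.
have Oy : closure OmO (l *: p + (1 - l) *: q) by exact: convex_closure.
have Ky : ~ K (l *: p + (1 - l) *: q).
  have l01' : 0 <= 1 - l <= 1 by lra.
  by have := av _ l01'; rewrite line_comb subKr addrC.
have hp : ((trunc n p)%:E <= G p)%E by rewrite truncK// ge_min lexx.
have hq : ((trunc n q)%:E <= G q)%E by rewrite truncK// ge_min lexx.
have Gmix := concave_segment scO lcG Op Oq av l01 hp hq.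
have /andP[_ b1] := trunc_bound n Op Kp; have /andP[_ b2] := trunc_bound n Oq Kq.
rewrite -lee_fin truncK// le_min Gmix lee_fin /=.
move: b1 b2 l01; move: (trunc n p) (trunc n q) (m + n%:R) => a b c ac bc /andP[l0 l1]; nra.
Qed.

Let trunc_split n s u t : 0 <= s -> s < u -> u < t -> t <= 1 -> avoids K (X s u) (X u t) ->
  good_split (fun s t => ~ K (X s t)) (fun s t => trunc n (X s t)) s u t.
Proof.
move=> s0 su ut t1 av.
have u0 := le_trans s0 (ltW su); have u1 := le_trans (ltW ut) t1.
have [Ksu Kut] := avoids_ends av.
have d0 := ltnW d1.
have Osu := slope_closure d0 s0 su u1; have Out := slope_closure d0 u0 ut t1.
split => //; apply: barycenter_le => //.
apply: (trunc_concave n Osu Out av); last exact: slope_barycenter.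
exact: barycenter01.
Qed.

(** The [n]-th step function has mesh below [1 / (n + 1)] and uses the truncation of [G] at [m + n],
    so one sequence serves both limits. Subtracting [m] makes everything nonnegative for Fatou's
    lemma. *)
Lemma integral_le_majorant : ~ K (X 0 1) ->
  (\int[mu]_(x in `[0%R, 1%R]) (f (psi x))%:E <= G (X 0 1))%E.
Proof.
move=> Kx0.
have [ipsi bpsi _] := psiA.
have [noray KO [intK dirs] _ compK] := std.
have d0 := ltnW d1.
have Ox0 := slope_closure d0 (lexx 0) ltr01 (lexx 1).
have split_near n (s t : R) : 0 <= s -> s < t -> t <= 1 -> exists2 k, 0 < k &
  \forall w \near (s, t), 0 <= w.1 -> w.1 < w.2 -> w.2 <= 1 -> ~ K (X w.1 w.2) ->
    exists2 u, w.1 + k <= u <= w.2 - k &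
      good_split (fun s t => ~ K (X s t)) (fun s t => trunc n (X s t)) w.1 u w.2.
  move=> s0 st t1.
  have [k k0 nk] := local_split clI clK intK compK ipsi slope_notin psi_notin s0 st t1.
  exists k => //; apply: filterS nk => w hw w0 w12 w1 Kw.
  have [u /andP[wu uw] av] := hw w0 w12 w1 Kw.
  exists u; first by rewrite wu.
  apply: trunc_split => //; first by rewrite (lt_le_trans _ wu)// ltrDl.
  by rewrite (le_lt_trans uw)// ltrBlDr ltrDl.
have tb n (s t : R) : 0 <= s -> s < t -> t <= 1 -> ~ K (X s t) -> m <= trunc n (X s t) <= m + n%:R.
  by move=> s0 st t1 Kst; exact: trunc_bound (slope_closure d0 s0 st t1) Kst.
have e0 n : 0 < n.+1%:R^-1 :> R by rewrite invr_gt0.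
have /boolp.choice[g hg] n := exists_fine_step (split_near n) (tb n) (e0 n) (lexx 0) ltr01 (lexx 1) Kx0.
have ig n : mu.-integrable `[0, 1] (EFin \o g n).
  by have [mg _ sg] := hg n; exact: (sampled_integrable (tb n) (lexx 0) (lexx 1) mg sg).
have mcst (c : R) : mu.-integrable ([set` `[0, 1]] : set R) (EFin \o cst c).
  apply: measurable_bounded_integrable => //; last exact: bounded_cst.
  by rewrite [ltLHS]lebesgue_measure_itv/= lte_fin ltr01 ltry.
have mu01 : mu ([set` `[0, 1]] : set R) = 1%:E.
  by rewrite lebesgue_measure_itv/= lte_fin ltr01 oppr0 adde0.
have mfpsi := measurable_fpsi.
have main : (\int[mu]_(x in `[0%R, 1%R]) (f (psi x) - m)%:E <= G (X 0 1) - m%:E)%E.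
  apply: (@fatou_bound _ ([set` `[0, 1]] : set R) [set p | ~ diff_pt psi p] (fun x => f (psi x) - m) (fun n x => g n x - m)) => //.
  - exact: ae_diff_pt.
  - by apply: measurable_funB => //; exact: measurable_cst.
  - by move=> n; have [mg _ _] := hg n; apply: measurable_funB => //; exact: measurable_cst.
  - by move=> x /=; rewrite in_itv/= subr_ge0 => /bpsi; exact: mf.
  - move=> n x /=; rewrite in_itv/= subr_ge0; have [_ _ hgn] := hg n.
    move=> /hgn[s [t [/andP[s0 sx] /andP[xt t1] st _] [Kst ->]]].
    by have /andP[] := tb n s t s0 st t1 Kst.
  - move=> x e /=; rewrite in_itv/= => x01 /contrapT dx ep.
    have [r r0 hr] := locally_concave_lsc d1 scO clK hull_sub lcG Gf cf (bpsi x x01) ep.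
    have r2 : 0 < r / 2 by rewrite divr_gt0.
    have [q q0 hq] := diff_pt_slope x01 dx r2.
    (* The first term puts the mesh below [q], the second puts the truncation level above
       [f (psi x)]. *)
    pose n0 := maxn (Num.truncn q^-1) (Num.truncn `|f (psi x) - m|).+1.
    exists n0 => n; rewrite geq_max => /andP[n1 n2].
    have nq : n.+1%:R^-1 < q.
      rewrite -[ltRHS]invrK ltf_pV2 ?posrE ?invr_gt0//.
      by rewrite (lt_le_trans (truncnS_gt _))// ler_nat ltnS.
    have nf : f (psi x) - m <= n%:R.
      rewrite (le_trans (ler_norm _))// (le_trans (ltW (truncnS_gt _)))//.
      by rewrite ler_nat.
    have [_ _ /(_ x x01)[s [t [/andP[s0 sx] /andP[xt t1] st tsn] [Kst ->]]]] := hg n.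
    have cst := slope_closure d0 s0 st t1.
    have Xr : `|psi x - X s t| < r.
      rewrite distrC (le_lt_trans (hq s t _ st _))//; [by rewrite sx|exact: lt_trans nq|lra].
    have := hr _ cst Xr => GX.
    have : f (psi x) - e <= trunc n (X s t).
      by rewrite -lee_fin truncK// le_min GX lee_fin; lra.
    lra.
  - move=> n; have [mg Ig _] := hg n.
    have igm : mu.-integrable `[0, 1] (EFin \o (fun x => g n x - m)).
      rewrite (_ : _ \o _ = ((EFin \o g n) \- (EFin \o cst m))%E)//.
      exact: integrableB.
    have E : \int[mu]_(x in `[0, 1]) (g n x - m) = \int[mu]_(x in `[0, 1]) g n x - m.
      rewrite (RintegralB _ (ig n) (mcst m))//; congr (_ - _).
      by rewrite (Rintegral_cst mu)// [X in fine X]mu01 mulr1.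
    have -> : (\int[mu]_(x in `[0%R, 1%R]) (g n x - m)%:E =
        (\int[mu]_(x in `[0%R, 1%R]) (g n x - m)%R)%:E)%E.
      by rewrite fineK//; exact: integrable_fin_num igm.
    rewrite [X in (X%:E <= _)%E]E EFinB; apply: leeB => //.
    apply: (@le_trans _ _ (trunc n (X 0 1))%:E).
      by rewrite lee_fin (le_trans Ig)// subr0 mul1r.
    by rewrite truncK// ge_min lexx.
have := G_ge Ox0 Kx0; move: main; case: (G (X 0 1)) => [r|_ _|_]; last 2 first.
- exact: leey.
- by rewrite leeNy_eq.
rewrite -EFinB => main _.
have mfm : measurable_fun ([set` `[0, 1]] : set R) (fun x => f (psi x) - m).
  by apply: measurable_funB => //; exact: measurable_cst.
(* Integrability of [f \o psi] is not assumed; when [G] is finite at the average it follows from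
   [main]. *)
have ifm : mu.-integrable `[0, 1] (EFin \o (fun x => f (psi x) - m)).
  apply/integrableP; split; first exact/measurable_EFinP.
  rewrite (le_lt_trans _ (ltry (r - m)))//; apply: le_trans main.
  rewrite le_eqVlt; apply/orP; left; apply/eqP; apply: eq_integral => x.
  rewrite inE/= in_itv/= => /bpsi /mf h.
  by rewrite ger0_norm// subr_ge0.
have -> : (\int[mu]_(x in `[0%R, 1%R]) (f (psi x))%:E =
  \int[mu]_(x in `[0%R, 1%R]) (f (psi x) - m)%:E + m%:E)%E.
  rewrite -[X in (_ + X)%E](_ : (\int[mu]_(x in `[0%R, 1%R]) (EFin \o cst m) x = m%:E)%E); last first.
    by rewrite (_ : EFin \o cst m = cst m%:E)// integral_cst//= [X in (_ * X)%E]mu01 mule1.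
  rewrite -integralD_EFin//; apply: eq_integral => x _ /=.
  by rewrite -EFinD subrK.
by rewrite -[r](subrK m) EFinD leeD2r.
Qed.

End Majorant.

End Main.

(** * The one-dimensional case *)

Section Line.
Context {R : realType}.
Local Notation V := 'rV[R]_1.
Local Notation mu := (@lebesgue_measure R).
Variables (OmO OmI : set V) (f : V -> R) (psi : R -> V).
Hypothesis scO : strictly_convex_open OmO.
Hypothesis clI : closed OmI.
Hypothesis std : standing_assumptions OmO OmI.
Hypothesis cf : {within bdry OmO, continuous f}.
Hypothesis psiA : A_Omega OmO OmI psi.
Local Notation K := (convhull OmI).
Local Notation X := (slope psi).

Lemma dotv_line (b x : V) : dotv b x = b 0 0 * x 0 0.
Proof. by rewrite /dotv big_ord_recl big_ord0 addr0. Qed.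

Lemma dotv_line_inj (b x y : V) : b != 0 -> dotv b x = dotv b y -> x = y.
Proof.
move=> b0; rewrite !dotv_line => bxy; apply/rowP => i; rewrite ord1.
apply: (mulfI _ bxy); apply: contra b0 => /eqP b00.
by apply/eqP/rowP => j; rewrite ord1 b00 mxE.
Qed.

Lemma hull_nonempty : K !=set0 -> OmI !=set0.
Proof.
move=> [k Kk]; apply: contrapT => nI.
by have := Kk set0; apply; [move=> x y t []|move=> x Ix; apply: nI; exists x].
Qed.

(** On a line, averages that vary continuously and avoid [k] stay on one side of it. *)
Lemma slope_above (b k : V) : b != 0 -> OmI k -> dotv b k < dotv b (X 0 1) ->
  forall s t, 0 <= s -> s < t -> t <= 1 -> dotv b k < dotv b (X s t).
Proof.
move=> b0 Ik bk s t s0 st t1; have [ipsi _ _] := psiA.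
have step (g : R -> V) (p q u w : R) : (forall v, p <= v <= q -> {for v, continuous g}) ->
    (forall v, p <= v <= q -> ~ OmI (g v)) -> p <= u <= q -> p <= w <= q ->
    dotv b k < dotv b (g u) -> dotv b k < dotv b (g w).
  move=> cg gI pu pw bu.
  apply: (@interval_clopen _ (fun v => dotv b k < dotv b (g v)) p q _ _ u w) => // v pv bv.
    have : \forall v' \near v, dotv b k < dotv b (g v').
      exact: (cg v pv [set y | dotv b k < dotv b y] (near_dotv_gt bv)).
    by apply: filterS.
  have bv' : dotv b (g v) < dotv b k.
    rewrite lt_neqAle leNgt; apply/andP; split; last exact/negP.
    by apply/eqP => /(dotv_line_inj b0) gk; apply: (gI v pv); rewrite gk.
  have : \forall v' \near v, dotv b (g v') < dotv b k.
    exact: (cg v pv [set y | dotv b y < dotv b k] (near_dotv_lt bv')).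
  by apply: filterS => v' h _; apply/negP; rewrite -leNgt ltW.
have s1 := lt_le_trans st t1.
(* The interval [[0, 1]] is deformed first to [[s, 1]] and then to [[s, t]], one endpoint at a
   time. *)
have b1 : dotv b k < dotv b (X s 1).
  apply: (step (fun v => X v 1) 0 s 0 s) bk; rewrite ?lexx ?s0//.
    by move=> v /andP[v0 vs]; apply: (slope_continuousl ipsi); rewrite (le_lt_trans vs).
  by move=> v /andP[v0 vs]; apply: (slope_notin psiA) => //; rewrite (le_lt_trans vs).
apply: (step (X s) t 1 1 t) b1; rewrite ?lexx ?t1//.
  by move=> v /andP[tv v1]; apply: (slope_continuousr ipsi); rewrite (lt_le_trans st).
by move=> v /andP[tv v1]; apply: (slope_notin psiA) => //; rewrite (lt_le_trans st).
Qed.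

(** Of two boundary points on the same side of [k], the nearer would lie strictly between [k] and
    the farther, hence in [OmO]. *)
Lemma bdry_above_inj (b k y z : V) : b != 0 -> OmO k -> bdry OmO y -> bdry OmO z ->
  dotv b k <= dotv b y -> dotv b k <= dotv b z -> y = z.
Proof.
move=> b0 Ok.
have [_ oO cO sc] := scO.
suff H y' z' : bdry OmO y' -> bdry OmO z' -> dotv b k <= dotv b y' -> ~ dotv b y' < dotv b z'.
  move=> by_ bz ky kz; apply: (dotv_line_inj b0); apply/eqP.
  by rewrite eq_le !leNgt; apply/andP; split; apply/negP; [exact: (H z y)|exact: (H y z)].
move=> /(bdry_open _ oO)[cy ny] /(bdry_open _ oO)[cz nz] ky yz.
have {}ky : dotv b k < dotv b y'.
  rewrite lt_neqAle ky andbT; apply/eqP => /(dotv_line_inj b0) ky'.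
  by apply: ny; rewrite -ky'.
pose t := (dotv b z' - dotv b y') / (dotv b z' - dotv b k).
have zk : 0 < dotv b z' - dotv b k by lra.
have t01 : 0 < t < 1.
  by rewrite /t ltr_pdivrMr// mul1r divr_gt0//=; lra.
have kz : k != z' by apply/eqP => kz'; move: zk; rewrite kz' subrr ltxx.
apply: ny; have := sc k z' t (subset_closure Ok) cz kz t01.
congr (OmO _); apply: (dotv_line_inj b0); rewrite dotvDr !dotvZr /t.
by field; rewrite gt_eqF.
Qed.

(** By differentiation almost every [psi x] is on the same side of [k] as the averages, so it is the
    only boundary point on that side. *)
Lemma line_constant : ~ K (X 0 1) -> exists2 z, bdry OmO z &
  X 0 1 = z /\ (\int[mu]_(x in `[0%R, 1%R]) (f (psi x))%:E = (f z)%:E)%E.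
Proof.
move=> Kx0; have [ipsi bpsi _] := psiA; have [_ oO _ _] := scO.
have [_ _ [[p0 /interior_subset Kp0] _] _ _] := std.
have [k Ik] : OmI !=set0 by apply: hull_nonempty; exists p0.
have [b b0 bK] := separation (ltn0Sn 0) (convex_convhull (A := OmI)) Kx0.
have Kk := sub_convhull Ik.
have bk : dotv b k < dotv b (X 0 1).
  rewrite lt_neqAle bK// andbT; apply/eqP => /(dotv_line_inj b0) kx.
  by apply: Kx0; rewrite -kx.
have Xk := slope_above b0 Ik bk.
have psik x : 0 <= x <= 1 -> diff_pt psi x -> dotv b k <= dotv b (psi x).
  move=> x01 dx; rewrite leNgt; apply/negP => xk.
  have /nbhs_dist[r r0 hr] := near_dotv_lt xk.
  have r2 : 0 < r / 2 by rewrite divr_gt0.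
  have [q q0 hq] := diff_pt_slope x01 dx r2.
  have [s [t [s0 t1 sxt st tq]]] : exists s t, [/\ 0 <= s, t <= 1, s <= x <= t, s < t & t - s < q].
    have /andP[x0 x1] := x01.
    have [xh|xh] := ltP x 1.
      exists x, (Num.min 1 (x + q / 2)).
      have h1 : x < Num.min 1 (x + q / 2) by rewrite lt_min xh ltrDl divr_gt0.
      have h2 : Num.min 1 (x + q / 2) <= x + q / 2 by rewrite ge_min lexx orbT.
      by split; rewrite ?lexx ?(ltW h1)// ?ge_min ?lexx//; lra.
    exists (Num.max 0 (x - q / 2)), x.
    have h1 : Num.max 0 (x - q / 2) < x by rewrite gt_max ltrBlDr ltrDl divr_gt0// andbT; lra.
    have h2 : x - q / 2 <= Num.max 0 (x - q / 2) by rewrite le_max lexx orbT.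
    by split; rewrite ?lexx ?(ltW h1)// ?le_max ?lexx//; lra.
  have Xr : `|psi x - X s t| < r by rewrite distrC (le_lt_trans (hq _ _ sxt st tq))//; lra.
  by have := lt_trans (hr _ Xr) (Xk s t s0 st t1); rewrite ltxx.
have [p /andP[p0' p1] /contrapT dp] := not_negligible_itv ltr01 (ae_diff_pt ipsi).
have p01 : 0 <= p <= 1 by rewrite !ltW.
have Ok : OmO k by exact: (hull_sub std).
pose z := psi p.
have psiz x : 0 <= x <= 1 -> diff_pt psi x -> psi x = z.
  move=> x01 dx; apply: (bdry_above_inj b0 Ok (bpsi x x01) (bpsi p p01)); exact: psik.
have mu01 : mu ([set` `[0, 1]] : set R) = 1%:E.
  by rewrite lebesgue_measure_itv/= lte_fin ltr01 oppr0 adde0.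
exists z; first exact: bpsi.
split.
  apply: (dotv_line_inj b0); apply/eqP; rewrite -subr_eq0; apply/eqP.
  have := dotv_slope ipsi b (dotv b z) (lexx 0) ltr01 (lexx 1).
  rewrite subr0 mulr1 => ->; rewrite (primB_cc (integrable_offset ipsi _ _) ler01) /Rintegral.
  rewrite (_ : (\int[mu]_(x in `[0%R, 1%R]) (offset psi b (dotv b z) x)%:E = \int[mu]_(x in `[0%R, 1%R]) 0)%E).
    by rewrite integral0.
  apply: ae_eq_integral => //.
    have := integrable_sub (integrable_offset ipsi b (dotv b z)) (measurable_itv_real `[0, 1]).
    by move=> /integrableP[].
  apply: negligibleS (ae_diff_pt ipsi) => x nx dx; apply: nx => /=; rewrite in_itv/= => x01.
  by rewrite /offset patchE mem_set/= ?in_itv//= psiz// subrr.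
transitivity (\int[mu]_(x in `[0%R, 1%R]) (cst (f z)%:E x))%E; last first.
  by rewrite integral_cst//= [X in (_ * X)%E]mu01 mule1.
apply: ae_eq_integral => //.
  by apply/measurable_EFinP; exact: (measurable_fpsi cf psiA).
apply: negligibleS (ae_diff_pt ipsi) => x nx dx; apply: nx => /=; rewrite in_itv/= => x01.
by rewrite psiz.
Qed.

End Line.

Unset Implicit Arguments.

(** Competitors are unconstrained outside [Omega_conv], so the average is placed in that set. The
    integral is taken in the extended reals, as [f] is bounded only from below. *)
Theorem theorem2 (R : realType) (d : nat) (OmO OmI : set 'rV[R]_d)
  (f : 'rV[R]_d -> R) (psi : R -> 'rV[R]_d) :
  (0 < d)%N ->
  strictly_convex_open OmO ->
  closed OmI -> OmI `<=` OmO ->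
  standing_assumptions OmO OmI ->
  {within bdry OmO, continuous f} ->
  (exists m : R, forall y, bdry OmO y -> m <= f y) ->
  A_Omega OmO OmI psi ->
  ~ interior (convhull OmI) (avg psi 0 1) ->
  Omega_conv OmO OmI (avg psi 0 1) ->
  (\int[lebesgue_measure]_(x in `[0%R, 1%R]) (f (psi x))%:E
     <= Bfrak OmO (Omega_conv OmO OmI) f (avg psi 0 1))%E.
Proof.
move=> d0 scO clI _ std cf [m mf] psiA _ [_ nK].
apply: le_ereal_inf_tmp => _ [G [lcG Gf] <-].
have Xavg : avg psi 0 1 = slope psi 0 1.
  by have [ipsi _ _] := psiA; rewrite (avgE ipsi).
rewrite Xavg in nK *.
have [d1|d1] := ltnP 1 d; first exact: (integral_le_majorant scO clI std cf psiA d1 mf lcG Gf nK).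
have d1' : d = 1%N by apply/eqP; rewrite eqn_leq d1.
subst d.
by have [z bz [-> ->]] := line_constant scO std cf psiA nK; rewrite Gf.
Qed.
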